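(* Fix $\epsilon>0$ and $p\in(0,1)$. Let $\mathcal G=(\mathcal N,\mathcal E)$ be a connected undirected graph on $\mathcal N=\{1,\dots,N\}$, and let $F_i=\rho_i+\gamma_i$ with $\rho_i\in\mathcal R$, $\gamma_i\in\Gamma$ for $i\in\mathcal N$, and $F^*=\min_{x\in\mathbb R^n}\sum_{i}F_i(x)$. Consider the asynchronous variant of DFAL for $\min\{\sum_iF_i(x_i): x_i=x_j\ \forall(i,j)\in\mathcal E\}$ in which the inexactness condition (a) is replaced by $$\mathbb P\Big(P^{(k)}(\mathbf x^{(k)})-P^{(k)}(\mathbf x_*^{(k)})\le\alpha^{(k)}\Big)\ \ge\ (1-p)^{\frac1{N(\epsilon)}},$$ where $N(\epsilon)=\log_{\frac1c}\big(\frac{\bar C}{\epsilon}\big)$. Then $\{x_i^{(N(\epsilon))}\}_{i\in\mathcal N}$ satisfies $$\mathbb P\left(\Big|\sum_{i\in\mathcal N}F_i\big(x_i^{(N(\epsilon))}\big)-F^*\Big|\le\epsilon\ \text{ and }\ \max_{(i,j)\in\mathcal E}\big\|x_i^{(N(\epsilon))}-x_j^{(N(\epsilon))}\big\|_2\le\epsilon\right)\ \ge\ 1-p,$$ and $\mathcal O\big(\frac1\epsilon\log\big(\frac1p\big)\big)$ ARBCD iterations are required to compute $\{x_i^{(N(\epsilon))}\}_{i\in\mathcal N}$.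
   Context: **Function classes.** $\Gamma$ is the set of convex $\gamma:\mathbb R^n\to\mathbb R$ such that $\nabla\gamma$ is Lipschitz continuous with constant $L_\gamma$ and $\gamma(x)\ge\underline\gamma$ for all $x$, for some $\underline\gamma\in\mathbb R$. $\mathcal R$ is the set of convex $\rho:\mathbb R^n\to\mathbb R$ for which there are $B>0$ with $\|q\|_2\le B$ for all $q\in\partial\rho(x)$, $x\in\mathbb R^n$, and $\tau>0$ with $\tau\|x\|_2\le\rho(x)$ for all $x\in\mathbb R^n$. Constants for $\gamma_i,\rho_i$ are written $L_{\gamma_i},\underline{\gamma_i},B_i,\tau_i$; $\bar\tau=\min_i\tau_i$. $\mathbf{prox}_\rho(x)=\arg\min_y\{\rho(y)+\frac12\|y-x\|_2^2\}$. **Matrix form.** $\Omega$ is the Laplacian of $\mathcal G$ and $d_i$ the degree of $i$. Orient each edge from smaller to larger index and let $C\in\mathbb R^{n|\mathcal E|\times nN}$ be the block matrix whose block row for edge $(i,j)$, $i<j$, has $I_n$ in block $i$, $-I_n$ in block $j$, zeros elsewhere, so $C^\top C=\Omega\otimes I_n$. With reduced SVD $C=U\Sigma V^\top$ put $A=\Sigma V^\top$, $b=0$; $A$ has full row rank, $A^\top A=\Omega\otimes I_n$, and $A\mathbf x=0$ iff $x_i=x_j$ for all $(i,j)\in\mathcal E$. **DFAL.** $\bar\rho(\mathbf x)=\sum_i\rho_i(x_i)$, $\bar\gamma(\mathbf x)=\sum_i\gamma_i(x_i)$, $\bar F=\bar\rho+\bar\gamma$. Fix $c\in(0,1)$, $\lambda^{(1)},\alpha^{(1)},\xi^{(1)}>0$,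 $\theta^{(1)}=0$. For $k\ge1$ let $f^{(k)}(\mathbf x)=\lambda^{(k)}\bar\gamma(\mathbf x)+\frac12\|A\mathbf x-b-\lambda^{(k)}\theta^{(k)}\|_2^2$, $P^{(k)}=\lambda^{(k)}\bar\rho+f^{(k)}$, $\mathbf x_*^{(k)}\in\arg\min P^{(k)}$. Iteration $k$: (1) compute $\mathbf x^{(k)}$ satisfying at least one of (a) $P^{(k)}(\mathbf x^{(k)})-P^{(k)}(\mathbf x^{(k)}_* )\le\alpha^{(k)}$; (b) there are $g_i^{(k)}\in\lambda^{(k)}\partial\rho_i(x_i^{(k)})+\nabla_{x_i}f^{(k)}(\mathbf x^{(k)})$ with $\max_i\|g^{(k)}_i\|_2\le\xi^{(k)}/\sqrt N$; (2) $\theta^{(k+1)}=\theta^{(k)}-(A\mathbf x^{(k)}-b)/\lambda^{(k)}$; (3) $\lambda^{(k+1)}=c\lambda^{(k)}$, $\alpha^{(k+1)}=c^2\alpha^{(k)}$, $\xi^{(k+1)}=c^2\xi^{(k)}$. The parameters satisfy $0<\lambda^{(1)}\le\bar\lambda$ and $\xi^{(1)}/\lambda^{(1)}<\bar\tau$, where $\bar\lambda>0$ (together with $B_x,B_\theta>0$) is a constant such that every such choice guarantees $\max\{\|\mathbf x_*^{(k)}\|_2,\|\mathbf x^{(k)}\|_2\}\le B_x$ and $\|\theta^{(k)}\|_2\le B_\theta$ for all $k\ge 1$, whenever every $\mathbf x^{(k)}$ satisfies (a) or (b). **Constant $\bar C$.** $\bar C>0$ is a constant independent of $\epsilon$ such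 that if every $\mathbf x^{(k)}$ satisfies (a) or (b), then $\|A\mathbf x^{(k)}-b\|_2\le\epsilon$ and $|\bar F(\mathbf x^{(k)})-F^*|\le\epsilon$ for all $k\ge\log_{1/c}(\bar C/\epsilon)$ (the paper shows such a $\bar C$ exists). $N(\epsilon)$ is rounded up to an integer when used as an index. **ARBCD** (accelerated randomized proximal block coordinate descent) for $\min_{\mathbf y\in\mathbb R^{nN}}\Phi(\mathbf y)=\sum_i\varrho_i(y_i)+f(\mathbf y)$ with block constants $L_i$, started at $\mathbf z^{(0)}$: $t^{(0)}=1$, $\mathbf u^{(0)}=0$; at iteration $\ell\ge0$ draw $i\in\mathcal N$ uniformly at random (independently of the past) and set $z_i^{(\ell+1)}=\mathbf{prox}_{t^{(\ell)}\varrho_i/L_i}\Big(z_i^{(\ell)}-\frac{t^{(\ell)}}{L_i}\nabla_{y_i}f\big((\tfrac1{Nt^{(\ell)}})^2\mathbf u^{(\ell)}+\mathbf z^{(\ell)}\big)\Big)$, $u_i^{(\ell+1)}=u_i^{(\ell)}+N^2t^{(\ell)}(1-t^{(\ell)})(z_i^{(\ell+1)}-z_i^{(\ell)})$, leaving all other blocks of $\mathbf z,\mathbf u$ unchanged; $t^{(\ell+1)}=\frac{1+\sqrt{1+(2Nt^{(\ell)})^2}}{2N}$. The point produced after iteration $T$ is $\big(\frac1{Nt^{(T)}}\big)^2\mathbf u^{(T+1)}+\mathbf z^{(T+1)}$. **Use of ARBCD in asynchronous DFAL.** The probabilistic condition for iteration $k$ is achieved by applying ARBCD to $P^{(k)}$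 (that is, $\varrho_i=\lambda^{(k)}\rho_i$, $f=f^{(k)}$, $L_i=\lambda^{(k)}L_{\gamma_i}+d_i$) started at $\mathbf x^{(k-1)}$: logarithmically many (in the inverse of the allowed failure probability, which is taken as $p/N(\epsilon)\le 1-(1-p)^{1/N(\epsilon)}$) independent calls are run, each for $\mathcal O(1/\sqrt{\alpha^{(k)}})$ iterations, so that each produces a point with expected suboptimality at most $\alpha^{(k)}/2$, and the produced point with the smallest value of $P^{(k)}$ is kept. The $\mathcal O(\cdot)$ in the claim hides factors independent of $\epsilon$ and $p$.
   Formalization: N(ε) is also rounded up in the exponent; the condition holds given earlier successes; the p/N(ε) implementation costs O((1/ε)log(N(ε)/p)), as log N(ε) is not O(log(1/p)); O((1/ε)log(1/p)) is shown for unequal failure splits, ε, p bounded (p away from 1); L_i>0. *)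

(* Defs.v *)
From HB Require Import structures.
From mathcomp Require Import all_boot all_order all_algebra mxtens.
From mathcomp Require Import all_classical all_reals all_analysis.

Set Implicit Arguments.
Unset Strict Implicit.
Unset Printing Implicit Defensive.

Import Order.TTheory GRing.Theory Num.Theory.
Import numFieldNormedType.Exports.

Local Open Scope classical_set_scope.
Local Open Scope ring_scope.

(* Points of R^n are row vectors; a point (x_1, ..., x_N) of R^(nN) is the
   N x n matrix whose i-th row is the block x_i. *)

Section EuclideanSpace.
Variable R : realType.

(* The library norm on matrices is the sup norm, hence this definition; on
   N x n matrices it is the Euclidean norm of the stacked vector. *)
Definition norm2 m n (x : 'M[R]_(m, n)) : R :=
  Num.sqrt (\sum_i \sum_j x i j ^+ 2).

Definition dot n (x y : 'rV[R]_n) : R := \sum_j x 0 j * y 0 j.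

(* Row i of the gradient is the gradient with respect to the block i. *)
Definition grad m n (f : 'M[R]_(m, n) -> R) (x : 'M[R]_(m, n)) :
    'M[R]_(m, n) :=
  \matrix_(i, j) 'D_(delta_mx i j) f x.

Definition subdiff n (f : 'rV[R]_n -> R) (x : 'rV[R]_n) : set 'rV[R]_n :=
  [set q | forall y, f x + dot q (y - x) <= f y].

Definition is_argmin (X : Type) (f : X -> R) (x : X) := forall y, f x <= f y.

(* This argmin is a singleton when f is convex and finite. *)
Definition prox n (f : 'rV[R]_n -> R) (x : 'rV[R]_n) : 'rV[R]_n :=
  xget 0 [set y | is_argmin (fun z => f z + 2^-1 * norm2 (z - x) ^+ 2) y].

Definition convex_fun n (f : 'rV[R]_n -> R) :=
  convex_function [set: convex_lmodType 'rV[R]_n] f.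

(* gamma is in the class Gamma, with constants L_gamma and lower bound lb. *)
Definition class_Gamma n (gamma : 'rV[R]_n -> R) (L lb : R) :=
  [/\ convex_fun gamma,
      forall x, differentiable gamma x,
      0 <= L /\
        forall x y, norm2 (grad gamma x - grad gamma y) <= L * norm2 (x - y)
    & forall x, lb <= gamma x].

(* rho is in the class R, with constants B and tau. *)
Definition class_R n (rho : 'rV[R]_n -> R) (B tau : R) :=
  [/\ convex_fun rho,
      0 < B /\ forall x q, subdiff rho x q -> norm2 q <= B
    & 0 < tau /\ forall x, tau * norm2 x <= rho x].

End EuclideanSpace.

Section Consensus.
Variables (R : realType) (N : nat) (e : rel 'I_N).

Definition simple_connected_graph :=
  [/\ symmetric e, irreflexive e & forall i j, connect e i j].

Definition degree (i : 'I_N) : nat := #|[set j | e i j]|.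

(* Each edge occurs once, oriented from its smaller to its larger end. *)
Definition edges : {set 'I_N * 'I_N} :=
  [set ij : 'I_N * 'I_N | (ij.1 < ij.2)%N && e ij.1 ij.2].

Definition incidence : 'M[R]_(#|edges|, N) :=
  \matrix_(k, i) ((i == (enum_val k).1)%:R - (i == (enum_val k).2)%:R).

(* Kronecker product with I_n: the (k, i) block of C is incidence k i *: I_n. *)
Definition consensus_mx n : 'M[R]_(#|edges| * n, N * n) :=
  tensmx incidence (1%:M : 'M[R]_n).

Definition stack n (x : 'M[R]_(N, n)) : 'cV[R]_(N * n) :=
  \col_k x (mxtens_unindex k).1 (mxtens_unindex k).2.

Definition reduced_svd p q r (C : 'M[R]_(p, q))
    (U : 'M[R]_(p, r)) (s : 'rV[R]_r) (V : 'M[R]_(q, r)) :=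
  [/\ U^T *m U = 1%:M, V^T *m V = 1%:M, forall i, 0 < s 0 i
    & C = U *m diag_mx s *m V^T].

End Consensus.

Record dfal_data (R : realType) (N n r : nat) := DFALData {
  rho : 'I_N -> 'rV[R]_n -> R;
  gam : 'I_N -> 'rV[R]_n -> R;
  Amx : 'M[R]_(r, N * n);
  cfac : R;
  lam1 : R;
  alpha1 : R;
  xi1 : R }.

Section DFAL.
Variables (R : realType) (N n r : nat) (D : dfal_data R N n r).
Local Notation point := 'M[R]_(N, n).

Definition Fbar (x : point) : R :=
  \sum_i (rho D i (row i x) + gam D i (row i x)).

Definition Fsum (x : 'rV[R]_n) : R := \sum_i (rho D i x + gam D i x).

(* Iterations are numbered from 1, as are the parameter sequences. *)
Definition lam (k : nat) : R := cfac D ^+ k.-1 * lam1 D.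
Definition alpha (k : nat) : R := (cfac D ^+ 2) ^+ k.-1 * alpha1 D.
Definition xi (k : nat) : R := (cfac D ^+ 2) ^+ k.-1 * xi1 D.

(* f^(k) and P^(k) for the multiplier th; the right-hand side b is 0. *)
Definition smooth_part (k : nat) (th : 'cV[R]_r) (x : point) : R :=
  lam k * (\sum_i gam D i (row i x)) +
  2^-1 * norm2 (Amx D *m stack x - lam k *: th) ^+ 2.

Definition augmented (k : nat) (th : 'cV[R]_r) (x : point) : R :=
  lam k * (\sum_i rho D i (row i x)) + smooth_part k th x.

Definition next_theta (k : nat) (th : 'cV[R]_r) (x : point) : 'cV[R]_r :=
  th - (lam k)^-1 *: (Amx D *m stack x).

Fixpoint theta_succ (x : nat -> point) (k : nat) : 'cV[R]_r :=
  if k is j.+1 then next_theta k (theta_succ x j) (x k) else 0.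

(* theta^(k), for k >= 1, when the iterates are x 1, x 2, ...; the value x 0
   is the starting point and is not used here. *)
Definition theta (x : nat -> point) (k : nat) : 'cV[R]_r := theta_succ x k.-1.

Definition Pk (x : nat -> point) (k : nat) : point -> R :=
  augmented k (theta x k).

Definition cond_a (x : nat -> point) (k : nat) : Prop :=
  exists2 xs, is_argmin (Pk x k) xs & Pk x k (x k) - Pk x k xs <= alpha k.

Definition cond_b (x : nat -> point) (k : nat) : Prop :=
  exists g : point, forall i,
    (exists2 q, subdiff (rho D i) (row i (x k)) q &
       row i g = lam k *: q +
                 row i (grad (smooth_part k (theta x k)) (x k))) /\
    norm2 (row i g) <= xi k / Num.sqrt N%:R.

Definition dfal_sequence (x : nat -> point) : Prop :=
  forall k, (0 < k)%N -> cond_a x k \/ cond_b x k.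

Definition dfal_bounds (Bx Btheta : R) : Prop :=
  forall x, dfal_sequence x -> forall k, (0 < k)%N ->
    [/\ forall xs, is_argmin (Pk x k) xs -> norm2 xs <= Bx,
        norm2 (x k) <= Bx & norm2 (theta x k) <= Btheta].

Definition log_inv_c (y : R) : R := ln y / ln (cfac D)^-1.

Definition dfal_rate (Fstar Cbar : R) : Prop :=
  forall x, dfal_sequence x -> forall eps : R, 0 < eps ->
  forall k, (0 < k)%N -> log_inv_c (Cbar / eps) <= k%:R ->
    norm2 (Amx D *m stack (x k)) <= eps /\ `|Fbar (x k) - Fstar| <= eps.

(* The logarithm rounded up to an integer, and to 1 when it is not positive
   (eps >= Cbar), since the first iterate has index 1. *)
Definition Neps (Cbar eps : R) : nat :=
  maxn 1 (absz (Num.max 0 (Num.ceil (log_inv_c (Cbar / eps))))).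

Definition eps_solution (e : rel 'I_N) (Fstar eps : R) (x : point) : Prop :=
  `|Fbar x - Fstar| <= eps /\
  forall i j, e i j -> norm2 (row i x - row j x) <= eps.

Section Async.
Variables (d : measure_display) (T : measurableType d) (P : probability T R).

Definition success (x : nat -> T -> point) (k : nat) : set T :=
  [set w | cond_a (fun j => x j w) k].

Definition past_success (useb : pred nat) (x : nat -> T -> point) (k : nat) :
    set T :=
  [set w | forall j, (0 < j < k)%N -> ~~ useb j -> success x j w].

(* Iterations 1, ..., K of the asynchronous variant. Iteration k either meets
   (b) (useb k) or meets (a) with probability at least (1 - p)^(1/K). That
   probability refers to the randomness of iteration k, so it is conditional on
   the previous iterations having succeeded: marginal bounds would only give
   1 - K (1 - (1 - p)^(1/K)) < 1 - p for the joint success. The conditional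
   probability is written as a product so that null past events need no special
   treatment. *)
Definition async_dfal (p : R) (K : nat) (useb : pred nat)
    (x : nat -> T -> point) : Prop :=
  [/\ forall k i j, (0 < k <= K)%N ->
        measurable_fun [set: T] (fun w => x k w i j),
      forall k w, (0 < k <= K)%N -> useb k -> cond_b (fun j => x j w) k
    & forall k, (0 < k <= K)%N -> ~~ useb k ->
        (((1 - p) `^ (K%:R)^-1)%:E * P (past_success useb x k) <=
         P (success x k `&` past_success useb x k))%E].

End Async.

End DFAL.

Section ARBCD.
Variables (R : realType) (N n : nat).
Local Notation point := 'M[R]_(N, n).
Variables (varrho : 'I_N -> 'rV[R]_n -> R) (f : point -> R) (L : 'I_N -> R).

Fixpoint arbcd_t (l : nat) : R :=
  if l is l'.+1 then
    (1 + Num.sqrt (1 + (2 * N%:R * arbcd_t l') ^+ 2)) / (2 * N%:R)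
  else 1.

Definition arbcd_point (l : nat) (z u : point) : point :=
  (1 / (N%:R * arbcd_t l)) ^+ 2 *: u + z.

Definition set_row (i : 'I_N) (v : 'rV[R]_n) (x : point) : point :=
  \matrix_(j < N) (if j == i then v else row j x).

Definition arbcd_step (l : nat) (i : 'I_N) (zu : point * point) :
    point * point :=
  let: (z, u) := zu in
  let t := arbcd_t l in
  let zi := prox (fun y => t / L i * varrho i y)
              (row i z - (t / L i) *: row i (grad f (arbcd_point l z u))) in
  (set_row i zi z,
   set_row i (row i u + (N%:R ^+ 2 * t * (1 - t)) *: (zi - row i z)) u).

(* (z^(l), u^(l)) when the block drawn at iteration j is draw j. *)
Fixpoint arbcd_state (z0 : point) (draw : nat -> 'I_N) (l : nat) :
    point * point :=
  if l is l'.+1 then arbcd_step l' (draw l') (arbcd_state z0 draw l')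
  else (z0, 0).

(* The point produced by M >= 1 iterations, that is after iteration M - 1: the
   weight uses t^(M-1), while z and u have index M. *)
Definition arbcd (z0 : point) (draw : nat -> 'I_N) (M : nat) : point :=
  let: (z, u) := arbcd_state z0 draw M in arbcd_point M.-1 z u.

End ARBCD.

Section AsyncARBCD.
Variables (R : realType) (N n r : nat) (D : dfal_data R N n r).
Local Notation point := 'M[R]_(N, n).
Variables (e : rel 'I_N) (Lgam : 'I_N -> R) (x0 : point).

(* Iteration k makes calls k independent calls of ARBCD, each of iters k
   iterations, and keeps the best point produced. The block drawn by iteration
   l of call s during iteration k is draw (k, s, l). *)
Variables (calls iters : nat -> nat) (draw : nat * nat * nat -> 'I_N).

Definition arbcd_call (k : nat) (th : 'cV[R]_r) (xprev : point) (s : nat) :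
    point :=
  arbcd (fun i y => lam D k * rho D i y) (smooth_part D k th)
    (fun i => lam D k * Lgam i + (degree e i)%:R)
    xprev (fun l => draw (k, s, l)) (iters k).

Definition best_call (k : nat) (th : 'cV[R]_r) (xprev : point) : point :=
  arbcd_call k th xprev
    [arg min_(s < ord0 : 'I_(calls k).-1.+1)
       augmented D k th (arbcd_call k th xprev s)]%O.

(* The pair (x^(k), theta^(k+1)). *)
Fixpoint arbcd_dfal_state (k : nat) : point * 'cV[R]_r :=
  if k is j.+1 then
    let: (xprev, th) := arbcd_dfal_state j in
    let xk := best_call k th xprev in (xk, next_theta D k th xk)
  else (x0, 0).

Definition arbcd_dfal (k : nat) : point := (arbcd_dfal_state k).1.

Definition total_iters (K : nat) : nat :=
  \sum_(1 <= k < K.+1) calls k * iters k.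

End AsyncARBCD.

(* Mutually independent draws, each uniform on the N blocks. *)
Definition iid_uniform (R : realType) (N : nat) (d : measure_display)
    (T : measurableType d) (P : probability T R) (J : eqType)
    (draw : J -> T -> 'I_N) : Prop :=
  (forall j v, measurable [set w | draw j w = v]) /\
  (forall (s : seq J) (v : J -> 'I_N), uniq s ->
     P [set w | forall j, j \in s -> draw j w = v j] =
     ((N%:R^-1) ^+ size s)%:E).

(* Main.v *)
Require Import Defs.
From HB Require Import structures.
From mathcomp Require Import all_boot all_order all_algebra mxtens.
From mathcomp Require Import all_classical all_reals all_analysis.
From mathcomp Require Import measurable_realfun ring lra.

Set Implicit Arguments.
Unset Strict Implicit.
Unset Printing Implicit Defensive.

Import Order.TTheory GRing.Theory Num.Theory.
Import numFieldNormedType.Exports.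

Local Open Scope classical_set_scope.
Local Open Scope ring_scope.

(** The proof has two halves.

    Success implies the conclusion.  If iterations 1, ..., K all meet one of the
    two inexactness conditions, completing the run with exact minimizers
    ([extend_run]) yields an infinite admissible run, to which the assumed rate
    and bounds apply; since [A] and the oriented incidence operator differ by an
    isometry, the norm of [A x] dominates every edge gap ([edge_gap_le]).  The
    conditional success probabilities multiply up ([past_success_ge]), and the
    event that all iterations succeed lies in the event of the conclusion.  Both
    events have to be shown measurable: success means that the value at the
    iterate is within [alpha] of the values at all rational points, because the
    augmented Lagrangian is continuous, a finite convex function being
    continuous ([convex_continuous]).

    The coordinate descent method achieves such success probabilities.  For one
    call, a potential that adds the weighted suboptimality and the weighted
    distance to a minimizer does not increase in mean ([potential_step]).  The
    nonsmooth terms are not evaluated at the iterate but replaced by upper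
    bounds that follow the convex combination of the points [z] defining it
    ([run_inv], [subconv]).  The step sizes grow linearly, so M iterations leave
    a mean suboptimality of order [W / M^2], where [W] is uniform over the
    iterations because iterates, multipliers and minimizers stay bounded
    ([uniform_start_gap]).  Hence [O(1 / sqrt alpha)] iterations make a call fail
    with probability at most 1/2 by Markov's inequality ([call_failure]), and m
    independent calls all fail with probability at most [2^-m]
    ([iteration_failure]).  The randomness enters through finitely many uniform
    draws only, so all these probabilities are finite means ([iid_avg]).

    The costs [1 / sqrt (alpha k)] grow geometrically like [c^-k], so their sum
    is of the order of the last one, which is [O(1 / eps)].  Giving every
    iteration the failure probability [p / K] costs a factor [ln (K / p)];
    giving iteration k the probability [p 2^-(K + 1 - k)] puts the strict
    requirements on the cheap early iterations and brings the factor down to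
    [ln (1 / p)]. *)

(** * Euclidean geometry of matrices *)

Section MatrixInnerProduct.
Variable R : realType.

Definition mdot m n (x y : 'M[R]_(m, n)) : R := \sum_i \sum_j x i j * y i j.

Section Bilinear.
Variables m n : nat.
Implicit Types x y z : 'M[R]_(m, n).

Lemma mdotC x y : mdot x y = mdot y x.
Proof. by apply: eq_bigr => i _; apply: eq_bigr => j _; rewrite mulrC. Qed.

Lemma mdotDl x y z : mdot (x + y) z = mdot x z + mdot y z.
Proof.
rewrite -big_split; apply: eq_bigr => i _ /=; rewrite -big_split.
by apply: eq_bigr => j _; rewrite !mxE mulrDl.
Qed.

Lemma mdotZl a x z : mdot (a *: x) z = a * mdot x z.
Proof.
rewrite mulr_sumr; apply: eq_bigr => i _; rewrite mulr_sumr.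
by apply: eq_bigr => j _; rewrite !mxE mulrA.
Qed.

Lemma mdotDr x y z : mdot z (x + y) = mdot z x + mdot z y.
Proof. by rewrite mdotC mdotDl !(mdotC z). Qed.

Lemma mdotZr a x z : mdot z (a *: x) = a * mdot z x.
Proof. by rewrite mdotC mdotZl (mdotC z). Qed.

Lemma mdotNl x z : mdot (- x) z = - mdot x z.
Proof. by rewrite -scaleN1r mdotZl mulN1r. Qed.

Lemma mdotNr x z : mdot z (- x) = - mdot z x.
Proof. by rewrite mdotC mdotNl (mdotC z). Qed.

Lemma mdot0r x : mdot x 0 = 0.
Proof. by rewrite -(scale0r 0) mdotZr mul0r. Qed.

Definition mdotE := (mdotDl, mdotDr, mdotZl, mdotZr, mdotNl, mdotNr).

Lemma mdot_ge0 x : 0 <= mdot x x.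
Proof.
by apply: sumr_ge0 => i _; apply: sumr_ge0 => j _; rewrite -expr2 sqr_ge0.
Qed.

Lemma norm2_sq x : norm2 x ^+ 2 = mdot x x.
Proof.
rewrite /norm2 sqr_sqrtr; last first.
  by apply: sumr_ge0 => i _; apply: sumr_ge0 => j _; rewrite sqr_ge0.
by apply: eq_bigr => i _; apply: eq_bigr => j _; rewrite expr2.
Qed.

Lemma norm2_ge0 x : 0 <= norm2 x.
Proof. exact: sqrtr_ge0. Qed.

Lemma norm2_le x (a : R) : 0 <= a -> (norm2 x <= a) = (mdot x x <= a ^+ 2).
Proof.
by move=> a0; rewrite -norm2_sq ler_pXn2r // nnegrE norm2_ge0.
Qed.

Lemma sqr_entry_le x i j : x i j ^+ 2 <= mdot x x.
Proof.
rewrite /mdot (bigD1 i) //= (bigD1 j) //= -expr2 -addrA lerDl addr_ge0 //.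
  by apply: sumr_ge0 => k _; rewrite -expr2 sqr_ge0.
by apply: sumr_ge0 => k _; apply: sumr_ge0 => l _; rewrite -expr2 sqr_ge0.
Qed.

Lemma entry_le_norm2 x i j : `|x i j| <= norm2 x.
Proof.
rewrite -(@ler_pXn2r _ 2) // ?nnegrE ?norm2_ge0 // norm2_sq real_normK //.
  exact: sqr_entry_le.
exact: num_real.
Qed.

Lemma cauchy_schwarz x y : mdot x y <= norm2 x * norm2 y.
Proof.
have [y0|y0] := eqVneq (mdot y y) 0.
  have -> : y = 0.
    apply/matrixP => i j; rewrite !mxE; apply/eqP; rewrite -sqrf_eq0.
    by rewrite eq_le sqr_ge0 andbT -y0 sqr_entry_le.
  by rewrite mdot0r mulr_ge0 // norm2_ge0.
have ygt0 : 0 < mdot y y by rewrite lt0r y0 mdot_ge0.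
have := mdot_ge0 (mdot y y *: x - mdot x y *: y).
rewrite !mdotE (mdotC y x) => h.
have {h} h : mdot x y ^+ 2 <= mdot x x * mdot y y.
  rewrite -(ler_pM2l ygt0) -subr_ge0; apply: le_trans h _.
  by rewrite le_eqVlt; apply/orP; left; apply/eqP; ring.
have [xy|xy] := leP (mdot x y) 0.
  by rewrite (le_trans xy) // mulr_ge0 // norm2_ge0.
have := h; rewrite -!norm2_sq -exprMn ler_pXn2r //; first exact: ltW.
by rewrite nnegrE mulr_ge0 // norm2_ge0.
Qed.

Lemma mdot_sqrD x y :
  mdot (x + y) (x + y) = mdot x x + 2 * mdot x y + mdot y y.
Proof. rewrite !mdotE (mdotC y x); ring. Qed.

Lemma mdot_sub_le2 x y : mdot (x - y) (x - y) <= 2 * mdot x x + 2 * mdot y y.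
Proof.
have := mdot_ge0 (x + y); rewrite !mdotE (mdotC y x); lra.
Qed.

End Bilinear.

Lemma mdot_rows m n (x y : 'M[R]_(m, n)) :
  mdot x y = \sum_i mdot (row i x) (row i y).
Proof.
apply: eq_bigr => i _; rewrite /mdot big_ord1.
by apply: eq_bigr => j _; rewrite !mxE.
Qed.

Lemma mdot_row_le m n i (x : 'M[R]_(m, n)) :
  mdot (row i x) (row i x) <= mdot x x.
Proof.
rewrite (mdot_rows x) [leRHS](bigD1 i) //= lerDl.
by apply: sumr_ge0 => k _; exact: mdot_ge0.
Qed.

Lemma mdot_rV n (x y : 'rV[R]_n) : mdot x y = \sum_j x 0 j * y 0 j.
Proof. by rewrite /mdot big_ord1. Qed.

Lemma mdot_cV n (x y : 'cV[R]_n) : mdot x y = \sum_j x j 0 * y j 0.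
Proof. by rewrite /mdot; apply: eq_bigr => i _; rewrite big_ord1. Qed.

Lemma mdot_mulmx p q (M : 'M[R]_(p, q)) (x : 'cV[R]_q) (y : 'cV[R]_p) :
  mdot (M *m x) y = mdot x (M^T *m y).
Proof.
rewrite !mdot_cV.
under eq_bigr => i _ do rewrite mxE mulr_suml.
rewrite exchange_big; apply: eq_bigr => j _.
rewrite mxE mulr_sumr; apply: eq_bigr => i _; rewrite !mxE; ring.
Qed.

End MatrixInnerProduct.

(** * Continuity and minimizers *)

Section ContinuousMinimizers.
Variable R : realType.

Lemma eq_continuous (T U : topologicalType) (f g : T -> U) :
  g =1 f -> continuous f -> continuous g.
Proof. by move/funext ->. Qed.

Lemma continuous_entries m n p q (g : 'M[R]_(m, n) -> 'M[R]_(p, q)) :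
  (forall i j, continuous (fun x => g x i j)) -> continuous g.
Proof.
move=> cg x; have FF := nbhs_filter x.
apply/cvg_ballP => e e0.
have : \forall y \near x, forall i j, ball (g x i j) e (g y i j : R).
  apply: (@filter_forall _ _ _ _ FF) => i.
  apply: (@filter_forall _ _ _ _ FF) => j.
  by have /cvg_ballP /(_ _ e0) := cg i j x.
by apply: filterS.
Qed.

Lemma continuous_row m n (i : 'I_m) : continuous (@row R m n i).
Proof.
apply: continuous_entries => k j.
apply: (eq_continuous (f := fun x : 'M[R]_(m, n) => x i j)) => [x|]; first by rewrite mxE.
exact: coord_continuous.
Qed.

Lemma continuous_sum (T : topologicalType) I (r : seq I) (F : I -> T -> R) :
  (forall i, continuous (F i)) -> continuous (fun x => \sum_(i <- r) F i x).
Proof.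
move=> cF; elim: r => [|i r IH].
  apply: (eq_continuous (f := fun=> 0)) => x; first by rewrite big_nil.
  exact: cvg_cst.
apply: (eq_continuous (f := fun x => F i x + \sum_(i <- r) F i x)) => x.
  by rewrite big_cons.
by apply: cvgD; [exact: cF | exact: IH].
Qed.

(** The growth hypothesis forces any point better than [0] into a fixed box. *)
Lemma coercive_argmin_rV n (F : 'rV[R]_n -> R) (a b : R) :
  continuous F -> 0 < a -> (forall (x : 'rV[R]_n) j, a * `|x 0 j| + b <= F x) ->
  exists y, is_argmin F y.
Proof.
move=> cF a0 coer.
pose r := Num.max 0 ((F 0 - b) / a).
pose box := [set v : 'rV[R]_n | forall i, (`[- r, r]%classic : set R) (v 0 i)].
have cbox : compact box.
  apply: (@rV_compact R n (fun=> `[- r, r]%classic)) => i.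
  exact: segment_compact.
have box0 : box 0 by move=> i; rewrite /= mxE in_itv /= oppr_le0 le_max lexx.
have [||c cin hc] := @compact_EVT_min _ _ F box _ cbox.
- by exists 0.
- by apply: continuous_subspaceT.
exists c => y; have [ybox|nbox] := pselect (box y).
  by apply: hc; exact/mem_set.
have [j hj] : exists j, ~ (`[- r, r]%classic : set R) (y 0 j).
  by apply/existsNP.
apply: le_trans (hc 0 (mem_set box0)) _.
apply: le_trans (coer y j); rewrite -lerBlDr mulrC -ler_pdivrMr //.
have [//|h] := leP ((F 0 - b) / a) `|y 0 j|.
case: hj; rewrite /= in_itv /= -ler_norml.
by rewrite (le_trans (ltW h)) // le_max lexx orbT.
Qed.

Lemma coercive_argmin m n (F : 'M[R]_(m, n) -> R) (a b : R) :
  continuous F -> 0 < a -> (forall (x : 'M[R]_(m, n)) i j, a * `|x i j| + b <= F x) ->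
  exists y, is_argmin F y.
Proof.
move=> cF a0 coer.
have [||y hy] := @coercive_argmin_rV _ (fun v => F (vec_mx v)) a b _ a0.
- move=> v; apply: continuous_comp; last exact: cF.
  apply: continuous_entries => i j.
  apply: (eq_continuous (f := fun x : 'rV[R]_(m * n) => x 0 (mxvec_index i j))) => [u|].
    by rewrite mxE.
  exact: coord_continuous.
- move=> v k; case/mxvec_indexP: k => i j.
  by have := coer (vec_mx v) i j; rewrite mxE.
by exists (vec_mx y) => x; rewrite -(mxvecK x); exact: hy.
Qed.

Lemma continuous_bounded_ball n (F : 'rV[R]_n -> R) (r : R) :
  continuous F -> exists M, forall x, norm2 x <= r -> F x <= M.
Proof.
move=> cF.
pose box := [set v : 'rV[R]_n | forall i, (`[- r, r]%classic : set R) (v 0 i)].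
have cbox : compact box.
  apply: (@rV_compact R n (fun=> `[- r, r]%classic)) => i.
  exact: segment_compact.
have inbox x : norm2 x <= r -> box x.
  move=> xr i; rewrite /= in_itv /= -ler_norml.
  exact: le_trans (entry_le_norm2 _ _ _) xr.
have [[x0 hx0]|none] := pselect (exists x, box x); last first.
  by exists 0 => x /inbox h; case: none; exists x.
have [||c cin hc] := @compact_EVT_max _ _ F box _ cbox.
- by exists x0.
- by apply: continuous_subspaceT.
by exists (F c) => x /inbox h; apply: hc; exact/mem_set.
Qed.

End ContinuousMinimizers.

(** * Convex functions *)

Section Convex.
Variables (R : realType) (n : nat).
Implicit Types (f : 'rV[R]_n -> R) (x y z xi : 'rV[R]_n).

Lemma convex_funP f (t : R) x y : convex_fun f -> 0 <= t <= 1 ->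
  f (t *: x + (1 - t) *: y) <= t * f x + (1 - t) * f y.
Proof.
move=> cf /andP[t0 t1].
have := cf (Itv01 t0 t1) x y; rewrite !inE => /(_ I I); rewrite /conv /=.
by [].
Qed.

Lemma convex_fun_scale f (c : R) : convex_fun f -> 0 <= c ->
  convex_fun (fun y => c * f y).
Proof.
move=> cf c0 s x y xin yin; rewrite /conv /=.
have := cf s x y xin yin; rewrite /conv /= => /(ler_wpM2l c0).
by rewrite mulrDr !scalerAr.
Qed.

(** [subconv f c xi v] says that [xi] and [v] behave as [sum_j c_j y_j] and
    [sum_j c_j f(y_j)] do for some weights [c_j >= 0] of sum [c <= 1]: a
    completion by any further point of weight [1 - c] satisfies Jensen's
    inequality.  This form of the perspective of [f] needs no division. *)
Definition subconv f (c : R) xi (v : R) :=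
  0 <= c <= 1 /\ forall y, f (xi + (1 - c) *: y) <= v + (1 - c) * f y.

Lemma subconv0 f : subconv f 0 0 0.
Proof. by split=> [|y]; rewrite ?lexx ?ler01 // subr0 scale1r mul1r !add0r. Qed.

Lemma subconv_scale f s c xi v : convex_fun f -> 0 <= s <= 1 ->
  subconv f c xi v -> subconv f (s * c) (s *: xi) (s * v).
Proof.
move=> cf /andP[s0 s1] [/andP[c0 c1] H]; split=> [|y].
  by rewrite mulr_ge0 //= mulr_ile1.
have -> : s *: xi + (1 - s * c) *: y =
          s *: (xi + (1 - c) *: y) + (1 - s) *: y.
  by apply/matrixP => i j; rewrite !mxE; ring.
apply: le_trans (convex_funP _ _ cf _) _; first by rewrite s0.
have := ler_wpM2l s0 (H y); lra.
Qed.

Lemma subconv_add f b c xi v z : convex_fun f -> 0 <= b -> c + b <= 1 ->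
  subconv f c xi v -> subconv f (c + b) (xi + b *: z) (v + b * f z).
Proof.
move=> cf b0 cb1 [/andP[c0 c1] H]; split=> [|y].
  by rewrite addr_ge0.
have [c1'|c1'] := eqVneq c 1.
  have b0' : b = 0 by apply/eqP; rewrite eq_le b0 andbT; lra.
  have := H y; rewrite b0' scale0r mul0r !addr0; exact.
have d0 : 0 < 1 - c by rewrite subr_gt0 lt_neqAle c1'.
pose t := b / (1 - c).
have t01 : 0 <= t <= 1.
  rewrite /t; apply/andP; split; first by rewrite divr_ge0 // ltW.
  by rewrite ler_pdivrMr // mul1r lerBrDl.
have tE : (1 - c) * t = b by rewrite /t mulrC divfK // gt_eqF.
have -> : xi + b *: z + (1 - (c + b)) *: y =
          xi + (1 - c) *: (t *: z + (1 - t) *: y).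
  apply/matrixP => i j; rewrite !mxE -tE; ring.
apply: le_trans (H _) _.
have := ler_wpM2l (ltW d0) (convex_funP z y cf t01).
have -> : (1 - c) * (t * f z + (1 - t) * f y) = b * f z + (1 - (c + b)) * f y.
  by rewrite -tE; ring.
lra.
Qed.

Lemma subconv_sum f I (r : seq I) (c : I -> R) (z : I -> 'rV[R]_n) :
  convex_fun f -> (forall i, 0 <= c i) -> \sum_(i <- r) c i <= 1 ->
  subconv f (\sum_(i <- r) c i) (\sum_(i <- r) c i *: z i)
    (\sum_(i <- r) c i * f (z i)).
Proof.
move=> cf c0; elim: r => [|i r IH]; first by rewrite !big_nil => _; exact: subconv0.
rewrite !big_cons => le1.
rewrite addrC [c i *: _ + _]addrC [c i * _ + _]addrC.
apply: subconv_add => //; first by rewrite addrC.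
by apply: IH; apply: le_trans le1; rewrite lerDr.
Qed.

(** A small displacement [h] is a combination of the [2n] points [x +- e_j]
    with weights [|h_j|], which bounds the increase of [f] linearly. *)
Lemma convex_local_bound f x : convex_fun f ->
  exists M, forall h : 'rV[R]_n, \sum_j `|h 0 j| <= 1 ->
    f (x + h) - f x <= M * \sum_j `|h 0 j|.
Proof.
move=> cf.
pose pt (s : bool) (j : 'I_n) := x + (-1) ^+ s *: delta_mx 0 j.
pose M := \sum_(j < n) (`|f (pt false j) - f x| + `|f (pt true j) - f x|).
exists M => h h1.
pose z j := pt (h 0 j < 0) j.
have [_ /(_ x)] := subconv_sum z cf (fun j => normr_ge0 (h 0 j)) h1.
have -> : \sum_j `|h 0 j| *: z j + (1 - \sum_j `|h 0 j|) *: x = x + h.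
  rewrite scalerBl scale1r addrCA; congr (_ + _).
  rewrite scaler_suml -sumrB [RHS]row_sum_delta; apply: eq_bigr => j _.
  rewrite /z /pt scalerDr addrAC subrr add0r scalerA; congr (_ *: _).
  by rewrite [RHS]realEsign ?num_real // mulrC.
rewrite mulrBl mul1r addrCA -lerBlDl => /le_trans; apply.
rewrite mulr_suml -sumrB mulr_sumr; apply: ler_sum => j _.
rewrite -mulrBr [leRHS]mulrC ler_wpM2l // (le_trans (ler_norm _)) //.
rewrite /M (bigD1 j) //=; set rest := \sum_(_ | _) _.
have rest0 : 0 <= rest by apply: sumr_ge0 => k _; rewrite addr_ge0.
rewrite /z; have := normr_ge0 (f (pt true j) - f x).
have := normr_ge0 (f (pt false j) - f x).
by case: (h 0 j < 0); lra.
Qed.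

(** Midpoint convexity at [x] turns the upper bound at [- h] into a lower bound
    at [h]. *)
Lemma convex_local_lipschitz f x : convex_fun f ->
  exists2 M, 0 <= M & forall h : 'rV[R]_n, \sum_j `|h 0 j| <= 1 ->
    `|f (x + h) - f x| <= M * \sum_j `|h 0 j|.
Proof.
move=> cf; have [M hM] := convex_local_bound x cf.
exists `|M| => // h h1; set S := \sum_j _.
have S0 : 0 <= S by apply: sumr_ge0.
have up : f (x + h) - f x <= `|M| * S.
  by apply: le_trans (hM h h1) _; rewrite ler_wpM2r // ler_norm.
have SN : \sum_j `|(- h) 0 j| = S by apply: eq_bigr => j _; rewrite mxE normrN.
have dn : f (x - h) - f x <= `|M| * S.
  by rewrite -SN; apply: le_trans (hM (- h) _) _; rewrite SN // ler_wpM2r // ler_norm.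
have mid : f x <= 2^-1 * f (x + h) + (1 - 2^-1) * f (x - h).
  rewrite -[X in f X <= _](_ : 2^-1 *: (x + h) + (1 - 2^-1) *: (x - h) = x).
    by apply: convex_funP => //; lra.
  by apply/matrixP => i j; rewrite !mxE; field.
rewrite ler_norml up andbT; lra.
Qed.

Lemma convex_continuous f : convex_fun f -> continuous f.
Proof.
move=> cf x; have [M M0 sym] := @convex_local_lipschitz f x cf.
have FF := nbhs_filter x.
apply/cvgrPdist_le => e e0.
pose d := Num.min 1 (e / (M + 1)).
have M1 : 0 < M + 1 by rewrite ltr_wpDl.
have d0 : 0 < d by rewrite lt_min ltr01 divr_gt0.
pose S (y : 'rV[R]_n) := \sum_j `|(y - x) 0 j|.
have cS : continuous S.
  apply: continuous_sum => j.
  apply: (eq_continuous (f := fun y : 'rV[R]_n => `|y 0 j - x 0 j|)) => y.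
    by rewrite !mxE.
  have FFy := nbhs_filter y.
  apply: cvg_norm; apply: cvgB; last exact: cvg_cst.
  exact: coord_continuous.
have Sx : S x = 0 by rewrite /S subrr big1 // => j _; rewrite mxE normr0.
have /cvgrPdist_le /(_ d d0) := cS x.
apply: filterS => y; rewrite Sx sub0r normrN ger0_norm; last exact: sumr_ge0.
rewrite le_min => /andP[Sy1 Sye].
have := sym _ Sy1; rewrite subrKC distrC => /le_trans; apply.
apply: (@le_trans _ _ ((M + 1) * S y)).
  by rewrite ler_wpM2r ?lerDl // sumr_ge0.
by rewrite mulrC -ler_pdivlMr.
Qed.

End Convex.

(** * Gradients *)

Section Gradients.
Variable R : realType.

(** Directional derivatives are derivatives of functions of one real variable,
    to which the calculus on [R] applies. *)
Lemma is_derive_line (V : normedModType R) (f : V -> R) (x v : V) (s d : R) :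
  is_derive (x + s *: v) v f d <-> is_derive s 1 (fun s => f (x + s *: v)) d.
Proof.
have E : (fun h : R => h^-1 *: ((f \o shift (x + s *: v)) (h *: v) -
                                f (x + s *: v))) =
         (fun h : R => h^-1 *: (((fun s => f (x + s *: v)) \o shift s) (h *: 1) -
                                f (x + s *: v))).
  apply/funext => h; congr (_ *: (f _ - _)).
  by rewrite /= addrCA; congr (_ + _); rewrite -scalerDl [h *: 1]mulr1.
split=> -[dv vE]; split; first by move: dv; rewrite /derivable E.
- by rewrite -vE /derive E.
- by move: dv; rewrite /derivable E.
- by rewrite -vE /derive E.
Qed.

Lemma is_derive_line0 (V : normedModType R) (f : V -> R) (x v : V) (d : R) :
  is_derive x v f d <-> is_derive (0 : R) 1 (fun s => f (x + s *: v)) d.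
Proof. by rewrite -is_derive_line scale0r addr0. Qed.

Lemma is_derive_quadratic (V : normedModType R) (f : V -> R) (x v : V)
    (a c : R) :
  (forall s, f (x + s *: v) = f x + s * a + s ^+ 2 * c) -> is_derive x v f a.
Proof.
move=> fE; apply/is_derive_line0; rewrite (funext fE).
apply: is_derive_eq.
by rewrite /GRing.scale /=; ring.
Qed.

Section MatrixGradient.
Variables m n : nat.
Implicit Types (f : 'M[R]_(m, n) -> R) (x v : 'M[R]_(m, n)).

(** Determines the gradient from a linear formula for all the directional
    derivatives. *)
Lemma grad_linear f x (l : 'M[R]_(m, n) -> R) :
  (forall a u v, l (a *: u + v) = a * l u + l v) ->
  (forall v, is_derive x v f (l v)) -> forall v, mdot (grad f x) v = l v.
Proof.
move=> lin fd v.
have l0 : l 0 = 0 by have := lin (-1) 0 0; rewrite scaler0 addr0 mulN1r addNr.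
have lsum I (r : seq I) (a : I -> R) (u : I -> 'M[R]_(m, n)) :
    l (\sum_(i <- r) a i *: u i) = \sum_(i <- r) a i * l (u i).
  by elim: r => [|i r IH]; rewrite ?big_nil // !big_cons lin IH.
have vE : v = \sum_i 1 *: (\sum_j v i j *: delta_mx i j).
  by under eq_bigr => i _ do rewrite scale1r; exact: matrix_sum_delta.
rewrite [in RHS]vE lsum; apply: eq_bigr => i _; rewrite mul1r lsum.
by apply: eq_bigr => j _; rewrite mxE mulrC; have [_ ->] := fd (delta_mx i j).
Qed.

Lemma differentiable_grad f x v :
  differentiable f x -> is_derive x v f (mdot (grad f x) v).
Proof.
move=> df; suff -> : mdot (grad f x) v = 'D_v f x by apply/derivableP/diff_derivable.
apply: (@grad_linear f x (fun v => 'D_v f x)) => [a u w|w].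
  by rewrite !deriveE // linearP.
exact/derivableP/diff_derivable.
Qed.

End MatrixGradient.

Section VectorGradient.
Variable n : nat.
Implicit Types (f : 'rV[R]_n -> R) (x y h : 'rV[R]_n).

(** For a step in [(0, 1]] towards [x], convexity bounds the difference quotient
    by [f x - f y]. *)
Lemma convex_grad_le f x y : convex_fun f -> differentiable f y ->
  f y + mdot (grad f y) (x - y) <= f x.
Proof.
move=> cf df; have [dv dE] := differentiable_grad (x - y) df.
rewrite addrC -lerBrDr -dE.
have cq := cvg_dnbhs_at_right dv.
apply: (cvgr_to_le cq).
near=> s.
have s0 : 0 < s by near: s; exact: nbhs_right_gt.
have s1 : s <= 1 by near: s; apply: nbhs_right_le; exact: ltr01.
change (s^-1 * (f (s *: (x - y) + y) - f y) <= f x - f y).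
rewrite ler_pdivrMl // lerBlDr.
have -> : s *: (x - y) + y = s *: x + (1 - s) *: y.
  by rewrite scalerBr scalerBl scale1r addrA addrAC.
apply: le_trans (convex_funP _ _ cf _) _; first by rewrite (ltW s0).
by rewrite le_eqVlt; apply/orP; left; apply/eqP; ring.
Unshelve. all: by end_near.
Qed.

(** Along the segment, the derivative exceeds its initial value by at most
    [s L |h|^2]; integrating in [s] gives the factor [1/2]. *)
Lemma descent f L y h : (forall x, differentiable f x) -> 0 <= L ->
  (forall x z, norm2 (grad f x - grad f z) <= L * norm2 (x - z)) ->
  f (y + h) <= f y + mdot (grad f y) h + L / 2 * mdot h h.
Proof.
move=> df L0 lip.
pose g0 := mdot (grad f y) h; pose hh := mdot h h.
pose phi := fun s : R => f (y + s *: h) - (s * g0 + s ^+ 2 * (L / 2 * hh)).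
pose dphi := fun s : R => mdot (grad f (y + s *: h)) h - (g0 + s * (L * hh)).
have dphiP (s : R) : is_derive s 1 phi (dphi s).
  have d1 : is_derive s 1 (fun s : R => f (y + s *: h))
      (mdot (grad f (y + s *: h)) h).
    exact: (proj1 (is_derive_line f y h s _)
      (differentiable_grad h (df (y + s *: h)))).
  have d2 : is_derive s 1 (fun s : R => s * g0 + s ^+ 2 * (L / 2 * hh))
      (g0 + s * (L * hh)).
    by apply: is_derive_eq; rewrite /GRing.scale /=; field.
  exact: is_deriveB d1 d2.
have dphi_le s : 0 <= s -> dphi s <= 0.
  move=> s0; rewrite /dphi opprD addrA subr_le0 -mdotNl -mdotDl.
  apply: le_trans (cauchy_schwarz _ _) _.
  have := lip (y + s *: h) y; rewrite [y + _]addrC addrK => lips.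
  apply: le_trans (ler_wpM2r (norm2_ge0 _) lips) _.
  have -> : norm2 (s *: h) = s * norm2 h.
    apply/eqP; rewrite -(@eqrXn2 _ 2) ?mulr_ge0 ?norm2_ge0 //.
    by rewrite exprMn !norm2_sq mdotZl mdotZr mulrA expr2.
  by rewrite /hh -norm2_sq le_eqVlt; apply/orP; left; apply/eqP; ring.
have [c c01 E] : exists2 c, c \in `[0, 1]%R & phi 1 - phi 0 = dphi c * (1 - 0).
  apply: MVT_segment => //; apply: continuous_subspaceT => t.
  by apply: differentiable_continuous; apply/derivable1_diffP; case: (dphiP t).
have : phi 1 <= phi 0.
  rewrite -subr_le0 E subr0 mulr1 dphi_le //.
  by move: c01; rewrite in_itv /= => /andP[].
rewrite /phi scale1r scale0r addr0 /g0 /hh; lra.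
Qed.

End VectorGradient.

End Gradients.

(** * The consensus penalty *)

Lemma sum_mxtens (V : nmodType) m n (F : 'I_(m * n) -> V) :
  \sum_k F k = \sum_i \sum_j F (mxtens_index (i, j)).
Proof.
rewrite (reindex (@mxtens_index m n)) /=; last first.
  by exists (@mxtens_unindex m n) => k _;
    [exact: mxtens_indexK | exact: mxtens_unindexK].
by rewrite pair_bigA; apply: eq_bigr => -[i j].
Qed.

Lemma incident_edges (N : nat) (e : rel 'I_N) (i : 'I_N) : symmetric e ->
  (\sum_(ab in edges e) ((ab.1 == i) + (ab.2 == i)) <= degree e i)%N.
Proof.
move=> syme.
rewrite (eq_bigl (fun ab : 'I_N * 'I_N => (ab.1 < ab.2)%N && e ab.1 ab.2));
  last by move=> ab; rewrite inE.
rewrite big_mkcond -(pair_bigA _ (fun a b : 'I_N =>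
  if (a < b)%N && e a b then ((a == i) + (b == i))%N else 0%N)) /=.
apply: (@leq_trans (\sum_(j < N) ((if (i < j)%N && e i j then 1 else 0) +
   (if (j < i)%N && e j i then 1 else 0)))%N).
  rewrite big_split /=.
  rewrite [X in (X <= _)%N](_ : _ =
    (\sum_(a < N) \sum_(b < N) (a == i) * (if (a < b)%N && e a b then 1 else 0) +
     \sum_(a < N) \sum_(b < N) (b == i) *
       (if (a < b)%N && e a b then 1 else 0))%N).
    rewrite leq_add //.
      rewrite (bigD1 i) //= [X in (_ + X)%N]big1 ?addn0.
        by apply: leq_sum => b _; rewrite eqxx mul1n.
      by move=> a /negPf ->; rewrite big1.
    apply: leq_sum => a _; rewrite (bigD1 i) //= eqxx mul1n big1 ?addn0 //.
    by move=> b /negPf ->.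
  rewrite -big_split; apply: eq_bigr => a _; rewrite -big_split.
  by apply: eq_bigr => b _ /=; case: ifP => _; rewrite ?muln1 ?muln0.
rewrite /degree -sum1_card [leqRHS]big_mkcond /=; apply: leq_sum => j _.
have -> : (j \in in_set [set j0 | e i j0]) = e i j.
  by apply/idP/idP => [/set_mem|/mem_set].
rewrite syme; case: (e j i); rewrite ?andbF // !andbT.
by case: ltngtP.
Qed.

Section Penalty.
Variables (R : realType) (N n r : nat) (e : rel 'I_N).
Variables (U : 'M[R]_(#|edges e| * n, r)) (s : 'rV[R]_r) (V : 'M[R]_(N * n, r)).
Variable A : 'M[R]_(r, N * n).
Hypothesis svd : reduced_svd (consensus_mx R e n) U s V.
Hypothesis A_def : A = diag_mx s *m V^T.
Implicit Types x y v : 'M[R]_(N, n).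

Lemma stackP a x y : stack (a *: x + y) = a *: stack x + stack y.
Proof. by apply/matrixP => i j; rewrite !mxE. Qed.

Lemma consensus_stackE x k j :
  (consensus_mx R e n *m stack x) (mxtens_index (k, j)) 0 =
  x (enum_val k).1 j - x (enum_val k).2 j.
Proof.
rewrite mxE sum_mxtens.
transitivity (\sum_i ((i == (enum_val k).1)%:R - (i == (enum_val k).2)%:R) * x i j).
  apply: eq_bigr => i _; rewrite (bigD1 j) //= big1 => [|l /negPf lj].
    by rewrite tensmxE !mxE mxtens_indexK eqxx mulr1 addr0.
  by rewrite tensmxE !mxE [j == l]eq_sym lj mulr0 mul0r.
under eq_bigr => i _ do rewrite mulrBl.
rewrite sumrB; congr (_ - _).
  rewrite (bigD1 (enum_val k).1) //= eqxx mul1r big1 ?addr0 // => i /negPf ->.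
  by rewrite mul0r.
rewrite (bigD1 (enum_val k).2) //= eqxx mul1r big1 ?addr0 // => i /negPf ->.
by rewrite mul0r.
Qed.

(** [A] and the oriented incidence operator differ by the isometry [U]. *)
Lemma penalty_sum x : mdot (A *m stack x) (A *m stack x) =
  \sum_(ij in edges e)
    mdot (row ij.1 x - row ij.2 x) (row ij.1 x - row ij.2 x).
Proof.
case: svd => UU _ _ CE.
have -> : mdot (A *m stack x) (A *m stack x) =
    mdot (consensus_mx R e n *m stack x) (consensus_mx R e n *m stack x).
  have -> : consensus_mx R e n = U *m A by rewrite CE A_def mulmxA.
  by rewrite -!(mulmxA U) [RHS]mdot_mulmx (mulmxA U^T) UU mul1mx.
rewrite mdot_cV sum_mxtens [RHS]big_enum_val; apply: eq_bigr => k _.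
by rewrite mdot_rV; apply: eq_bigr => j _; rewrite !consensus_stackE !mxE.
Qed.

Lemma edge_gap_le x : symmetric e -> irreflexive e -> forall i j, e i j ->
  norm2 (row i x - row j x) <= norm2 (A *m stack x).
Proof.
move=> syme irre.
have lt i j : e i j -> (i < j)%N ->
    mdot (row i x - row j x) (row i x - row j x) <=
    mdot (A *m stack x) (A *m stack x).
  move=> eij ij; rewrite penalty_sum (bigD1 (i, j)) /=; last by rewrite inE ij.
  by rewrite lerDl sumr_ge0 // => k _; exact: mdot_ge0.
move=> i j eij; rewrite norm2_le ?norm2_ge0 // norm2_sq.
have [ij|ji|ij] := ltngtP i j; first exact: lt.
  have := lt _ _ _ ji; rewrite syme => /(_ eij); apply: le_trans.
  by rewrite -[row i x - row j x]opprB mdotNl mdotNr opprK.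
by move: eij; rewrite (val_inj ij) irre.
Qed.

(** Only the edges at [i] see a displacement of the block [i]: this is where the
    degree in the block constant comes from. *)
Lemma penalty_block i v : symmetric e ->
  (forall j, j != i -> row j v = 0) ->
  mdot (A *m stack v) (A *m stack v) <= (degree e i)%:R * mdot v v.
Proof.
move=> syme v0.
have vv : mdot v v = mdot (row i v) (row i v).
  rewrite mdot_rows (bigD1 i) //= big1 ?addr0 // => j /v0 ->; exact: mdot0r.
rewrite vv penalty_sum.
have rowE j : row j v = (j == i)%:R *: row i v.
  by case: eqVneq => [->|/v0 ->]; rewrite ?scale1r ?scale0r.
apply: (@le_trans _ _ (\sum_(ab in edges e)
   ((ab.1 == i)%:R + (ab.2 == i)%:R) * mdot (row i v) (row i v))).
  apply: ler_sum => -[a b] /=; rewrite inE /= => /andP[ab _].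
  rewrite (rowE a) (rowE b) -scalerBl mdotZl mdotZr mulrA ler_wpM2r ?mdot_ge0 //.
  by case: (a == i); case: (b == i); rewrite /=; lra.
rewrite -mulr_suml ler_wpM2r ?mdot_ge0 //.
rewrite (_ : \sum_(ab in _) _ = \sum_(ab in edges e) ((ab.1 == i) + (ab.2 == i))%:R);
  last by apply: eq_bigr => ab _; rewrite natrD.
rewrite -natr_sum ler_nat.
exact: incident_edges.
Qed.

Lemma penalty_le x : mdot (A *m stack x) (A *m stack x) <=
  (4 * #|edges e|)%:R * mdot x x.
Proof.
rewrite penalty_sum.
apply: (@le_trans _ _ (\sum_(ij in edges e) 4 * mdot x x)).
  apply: ler_sum => ij _; apply: le_trans (mdot_sub_le2 _ _) _.
  have := mdot_row_le ij.1 x; have := mdot_row_le ij.2 x; lra.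
by rewrite sumr_const natrM -[_ *+ #|_|]mulr_natl mulrA [4 * _]mulrC.
Qed.

End Penalty.

(** * The smooth part of the augmented Lagrangian *)

Section SmoothPart.
Variables (R : realType) (N n r : nat) (e : rel 'I_N) (D : dfal_data R N n r).
Variables (U : 'M[R]_(#|edges e| * n, r)) (s : 'rV[R]_r) (V : 'M[R]_(N * n, r)).
Variables (Lgam lbgam B tau : 'I_N -> R).
Hypothesis syme : symmetric e.
Hypothesis svd : reduced_svd (consensus_mx R e n) U s V.
Hypothesis A_def : Amx D = diag_mx s *m V^T.
Hypothesis gamP : forall i, class_Gamma (gam D i) (Lgam i) (lbgam i).
Hypothesis rhoP : forall i, class_R (rho D i) (B i) (tau i).
Hypothesis lam_gt0 : forall k, 0 < lam D k.
Implicit Types (x y v : 'M[R]_(N, n)) (th : 'cV[R]_r).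

Definition residual k th x := Amx D *m stack x - lam D k *: th.

Lemma residual_line k th a x y :
  residual k th (x + a *: y) = residual k th x + a *: (Amx D *m stack y).
Proof. by rewrite /residual (addrC x) stackP mulmxDr -scalemxAr -addrA addrC. Qed.

Definition smooth_derive k th x v : R :=
  lam D k * (\sum_i mdot (grad (gam D i) (row i x)) (row i v)) +
  mdot (residual k th x) (Amx D *m stack v).

Lemma gam_continuous i : continuous (gam D i).
Proof. by case: (gamP i) => cf _ _ _; exact: convex_continuous. Qed.

Lemma rho_continuous i : continuous (rho D i).
Proof. by case: (rhoP i) => cf _ _; exact: convex_continuous. Qed.

Lemma is_derive_smooth k th x v :
  is_derive x v (smooth_part D k th) (smooth_derive k th x v).
Proof.
rewrite is_derive_line0.
pose q y := 2^-1 * norm2 (residual k th y) ^+ 2.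
have dq : is_derive (0 : R) 1 (fun t => q (x + t *: v))
    (mdot (residual k th x) (Amx D *m stack v)).
  apply: (proj1 (is_derive_line0 q x v _)); apply: (@is_derive_quadratic _ _ _
    _ _ _ (2^-1 * mdot (Amx D *m stack v) (Amx D *m stack v))) => t.
  by rewrite /q !norm2_sq residual_line mdot_sqrD mdotZr mdotZl mdotZr; field.
have dg i : is_derive (0 : R) 1 (fun t => gam D i (row i (x + t *: v)))
    (mdot (grad (gam D i) (row i x)) (row i v)).
  have -> : (fun t => gam D i (row i (x + t *: v))) =
            (fun t => gam D i (row i x + t *: row i v)).
    by apply/funext => t; rewrite linearD linearZ.
  apply: (proj1 (is_derive_line0 (gam D i) (row i x) (row i v) _)).
  by apply: differentiable_grad; case: (gamP i) => _ /(_ (row i x)).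
have ds := @is_derive_sum _ _ _ _ _ _ _ _ dg.
have := is_deriveD (is_deriveZ (lam D k) ds) dq.
congr is_derive.
apply/funext => t; rewrite /smooth_part /q /residual; congr (_ * _ + _).
by rewrite fct_sumE.
Qed.

Lemma grad_smooth k th x v :
  mdot (grad (smooth_part D k th) x) v = smooth_derive k th x v.
Proof.
apply: (@grad_linear _ _ _ _ _ (smooth_derive k th x)) => [a u w|w].
  rewrite /smooth_derive stackP mulmxDr -scalemxAr mdotDr mdotZr.
  under eq_bigr => i _ do rewrite linearP mdotDr mdotZr.
  rewrite big_split -mulr_sumr /=; ring.
exact: is_derive_smooth.
Qed.

Lemma smooth_expand k th x v : smooth_part D k th (x + v) =
  lam D k * (\sum_i gam D i (row i x + row i v)) +
  2^-1 * norm2 (residual k th x) ^+ 2 + mdot (residual k th x) (Amx D *m stack v) +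
  2^-1 * mdot (Amx D *m stack v) (Amx D *m stack v).
Proof.
rewrite /smooth_part -/(residual _ _ _) -[v in X in _ + X]scale1r residual_line scale1r.
rewrite (eq_bigr (fun i => gam D i (row i x + row i v))); last first.
  by move=> i _; rewrite linearD.
by rewrite !norm2_sq mdot_sqrD; field.
Qed.

Lemma smooth_convex k th x y :
  smooth_part D k th y + mdot (grad (smooth_part D k th) y) (x - y) <=
  smooth_part D k th x.
Proof.
rewrite -[in leRHS](subrKC y x) smooth_expand grad_smooth /smooth_derive.
rewrite [in leLHS]/smooth_part -/(residual k th y).
have H : \sum_i gam D i (row i y) +
    \sum_i mdot (grad (gam D i) (row i y)) (row i (x - y)) <=
    \sum_i gam D i (row i y + row i (x - y)).
  rewrite -big_split; apply: ler_sum => i _.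
  case: (gamP i) => cf /(_ (row i y)) df _ _.
  by have := convex_grad_le (row i y + row i (x - y)) cf df; rewrite addrAC subrr add0r.
have := ler_wpM2l (ltW (lam_gt0 k)) H.
have := mdot_ge0 (Amx D *m stack (x - y)).
rewrite mulrDr; lra.
Qed.

Lemma smooth_block k th i y v : (forall j, j != i -> row j v = 0) ->
  smooth_part D k th (y + v) <= smooth_part D k th y +
    mdot (grad (smooth_part D k th) y) v +
    (lam D k * Lgam i + (degree e i)%:R) / 2 * mdot v v.
Proof.
move=> v0; rewrite smooth_expand grad_smooth /smooth_derive.
rewrite [in leRHS]/smooth_part -/(residual k th y).
have vv : mdot v v = mdot (row i v) (row i v).
  rewrite mdot_rows (bigD1 i) //= big1 ?addr0 // => j /v0 ->; exact: mdot0r.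
have H : \sum_i gam D i (row i y + row i v) <= \sum_i gam D i (row i y) +
    \sum_i mdot (grad (gam D i) (row i y)) (row i v) + Lgam i / 2 * mdot v v.
  rewrite -big_split /= (bigD1 i) //= [X in _ <= X + _](bigD1 i) //=.
  rewrite (eq_bigr (fun j => gam D j (row j y) +
      mdot (grad (gam D j) (row j y)) (row j v))); last first.
    by move=> j /v0 ->; rewrite mdot0r !addr0.
  case: (gamP i) => _ df [L0 lip] _.
  have := descent (row i y) (row i v) df L0 lip; rewrite vv; lra.
have := ler_wpM2l (ltW (lam_gt0 k)) H.
have := penalty_block svd A_def syme v0.
rewrite !mulrDr; lra.
Qed.

Lemma continuous_mx_stack q (M : 'M[R]_(q, N * n)) i j :
  continuous (fun x => (M *m stack x) i j).
Proof.
apply: (eq_continuous (f := fun x : 'M[R]_(N, n) => \sum_k M i k *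
   x (mxtens_unindex k).1 (mxtens_unindex k).2)) => [x|].
  by rewrite mxE; apply: eq_bigr => k _; rewrite mxE.
apply: continuous_sum => k x; have FF := nbhs_filter x.
by apply: cvgM; [exact: cvg_cst | exact: coord_continuous].
Qed.

Lemma augmented_continuous k th : continuous (augmented D k th).
Proof.
have crow (F : 'I_N -> 'rV[R]_n -> R) : (forall i, continuous (F i)) ->
    continuous (fun x : 'M[R]_(N, n) => \sum_i F i (row i x)).
  move=> cF; apply: continuous_sum => i x.
  by apply: continuous_comp; [exact: continuous_row | exact: cF].
have cq : continuous (fun x => \sum_i residual k th x i 0 ^+ 2).
  apply: continuous_sum => i.
  apply: (eq_continuous (f := fun x : 'M[R]_(N, n) =>
    ((Amx D *m stack x) i 0 - lam D k * th i 0) *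
    ((Amx D *m stack x) i 0 - lam D k * th i 0))) => [x|x].
    by rewrite /residual expr2 !mxE.
  have FF := nbhs_filter x.
  by apply: cvgM; (apply: cvgB; [exact: continuous_mx_stack | exact: cvg_cst]).
apply: (eq_continuous (f := fun x => lam D k * (\sum_i rho D i (row i x)) +
  (lam D k * (\sum_i gam D i (row i x)) +
   2^-1 * \sum_i residual k th x i 0 ^+ 2))) => [x|x].
  rewrite /augmented /smooth_part norm2_sq mdot_cV.
  congr (_ + (_ + _ * _)); by apply: eq_bigr => i _; rewrite expr2.
have FF := nbhs_filter x.
apply: cvgD; last apply: cvgD.
- by apply: cvgM; [exact: cvg_cst | apply: crow; exact: rho_continuous].
- by apply: cvgM; [exact: cvg_cst | apply: crow; exact: gam_continuous].
- by apply: cvgM; [exact: cvg_cst | exact: cq].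
Qed.

Lemma rho_ge0 i (x : 'rV[R]_n) : 0 <= rho D i x.
Proof.
case: (rhoP i) => _ _ [t0 /(_ x)]; apply: le_trans.
by rewrite mulr_ge0 ?norm2_ge0 // ltW.
Qed.

Lemma augmented_ge k th x :
  lam D k * (\sum_i lbgam i) <= augmented D k th x.
Proof.
rewrite /augmented /smooth_part addrA -mulrDr.
apply: (@le_trans _ _ (lam D k * (\sum_i rho D i (row i x) + \sum_i gam D i (row i x)))).
  rewrite ler_pM2l // -[leLHS]add0r lerD //.
    by apply: sumr_ge0 => i _; exact: rho_ge0.
  by apply: ler_sum => i _; case: (gamP i).
by rewrite lerDl mulr_ge0 ?invr_ge0 // exprn_ge0 // norm2_ge0.
Qed.

(** The terms [rho D i] grow linearly and the rest is bounded below. *)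
Lemma augmented_argmin k th : exists x, is_argmin (augmented D k th) x.
Proof.
pose t := \big[Num.min/1]_i tau i.
have t0 : 0 < t.
  rewrite /t; elim/big_ind: _ => // [a b a0 b0|i _]; first by rewrite lt_min a0.
  by case: (rhoP i) => _ _ [].
apply: (@coercive_argmin _ _ _ _ (lam D k * t) (lam D k * \sum_i lbgam i)).
- exact: augmented_continuous.
- by rewrite mulr_gt0.
- move=> x i j; rewrite /augmented /smooth_part addrA -mulrDr -mulrA -mulrDr.
  apply: (@le_trans _ _ (lam D k * (\sum_i rho D i (row i x) + \sum_i gam D i (row i x)))).
    rewrite ler_pM2l // lerD //; last first.
      by apply: ler_sum => l _; case: (gamP l).
    rewrite (bigD1 i) //=.
    have : 0 <= \sum_(l | l != i) rho D l (row l x).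
      by apply: sumr_ge0 => l _; exact: rho_ge0.
    have : t * `|x i j| <= rho D i (row i x).
      case: (rhoP i) => _ _ [ti0 /(_ (row i x))]; apply: le_trans.
      apply: ler_pM => //; [exact: ltW | exact: bigmin_le |].
      by have := entry_le_norm2 (row i x) 0 j; rewrite mxE.
    lra.
  by rewrite lerDl mulr_ge0 ?invr_ge0 // exprn_ge0 // norm2_ge0.
Qed.

End SmoothPart.

(** * Accelerated randomized block coordinate descent *)

Section StepSizes.
Variables (R : realType) (N : nat).
Hypothesis N_gt0 : (0 < N)%N.
Local Notation t := (arbcd_t R N).

Let N0 : 0 < N%:R :> R. Proof. by rewrite ltr0n. Qed.

Lemma arbcd_t_ge l : 1 + l%:R / (2 * N%:R) <= t l.
Proof.
elim: l => [|l IH]; first by rewrite mul0r addr0.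
have t0 : 0 <= t l.
  by apply: le_trans IH; rewrite addr_ge0 // divr_ge0 // mulr_ge0 // ltW.
rewrite /= -natr1 mulrDl addrA mul1r.
apply: (@le_trans _ _ ((1 + 2 * N%:R * t l) / (2 * N%:R))).
  have -> : (1 + 2 * N%:R * t l) / (2 * N%:R) = t l + (2 * N%:R)^-1.
    by field; rewrite gt_eqF.
  by rewrite lerD2r.
rewrite ler_pM2r ?invr_gt0 ?mulr_gt0 // lerD2l.
have x0 : 0 <= 2 * N%:R * t l by rewrite !mulr_ge0 // ltW.
rewrite -[leLHS](ger0_norm x0) -sqrtr_sqr ler_sqrt ?lerDr //.
by rewrite addr_ge0 // sqr_ge0.
Qed.

Lemma arbcd_t_ge1 l : 1 <= t l.
Proof.
by apply: le_trans (arbcd_t_ge l); rewrite lerDl divr_ge0 // mulr_ge0 // ltW.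
Qed.

(** With [th = 1 / (N t)], this is the usual recurrence
    [(1 - th_{l+1}) / th_{l+1}^2 = 1 / th_l^2], which makes the potential of
    consecutive iterations fit together. *)
Lemma arbcd_tS l : N%:R * t l.+1 ^+ 2 - t l.+1 = N%:R * t l ^+ 2.
Proof.
have /= := arbcd_t_ge1 l.+1; set q := Num.sqrt _ => _.
have : q ^+ 2 = 1 + (2 * N%:R * t l) ^+ 2.
  by rewrite sqr_sqrtr // addr_ge0 // sqr_ge0.
move=> qE; have Nn : N%:R != 0 :> R by rewrite gt_eqF.
have -> : N%:R * ((1 + q) / (2 * N%:R)) ^+ 2 - (1 + q) / (2 * N%:R) =
          (q ^+ 2 - 1) / (4 * N%:R) by field.
by rewrite qE; field.
Qed.

(** Every iterate is a combination of the points [z] produced so far; this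
    inequality keeps the weights of that combination nonnegative. *)
Lemma arbcd_tS_le l : (N%:R - 1) * t l.+1 <= N%:R * t l.
Proof.
have t1 := arbcd_t_ge1 l; have t1' := arbcd_t_ge1 l.+1.
have tE := arbcd_tS l.
have N1 : 1 <= N%:R :> R by rewrite ler1n.
have le1 : t l.+1 <= t l + N%:R^-1.
  rewrite leNgt; apply/negP => lt.
  have : N%:R * (t l.+1 - t l) * (t l.+1 + t l) = t l.+1 by nra.
  have : 1 < N%:R * (t l.+1 - t l).
    by rewrite -ltr_pdivrMl // mulr1 ltrBrDl.
  nra.
have : (N%:R - 1) * t l.+1 <= (N%:R - 1) * (t l + N%:R^-1).
  by rewrite ler_wpM2l // subr_ge0.
move/le_trans; apply.
have -> : (N%:R - 1) * (t l + N%:R^-1) = N%:R * t l - t l + 1 - N%:R^-1.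
  by field; rewrite gt_eqF.
have : 0 < N%:R^-1 :> R by rewrite invr_gt0.
lra.
Qed.

End StepSizes.

Section Prox.
Variables (R : realType) (n : nat).
Implicit Types (f : 'rV[R]_n -> R) (x p v w : 'rV[R]_n).

Lemma prox_argmin f w : convex_fun f -> (forall x, 0 <= f x) ->
  is_argmin (fun y => f y + 2^-1 * norm2 (y - w) ^+ 2) (prox f w).
Proof.
move=> cf f0; rewrite /prox; case: xgetP => [y -> //|none].
have [||y /none] := @coercive_argmin R 1 n
  (fun y => f y + 2^-1 * norm2 (y - w) ^+ 2) 1 (- norm2 w - 2^-1) _ ltr01.
- apply: (eq_continuous (f := fun y => f y +
     2^-1 * \sum_j (y 0 j - w 0 j) * (y 0 j - w 0 j))) => [y|y].
    rewrite norm2_sq mdot_rV; congr (_ + _ * _).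
    by apply: eq_bigr => j _; rewrite !mxE.
  have FF := nbhs_filter y.
  apply: cvgD; first exact: convex_continuous.
  apply: cvgM; first exact: cvg_cst.
  apply: (@continuous_sum R _ _ _
    (fun j (y : 'rV[R]_n) => (y 0 j - w 0 j) * (y 0 j - w 0 j))) => j x.
  have FFx := nbhs_filter x.
  by apply: cvgM; (apply: cvgB; [exact: coord_continuous | exact: cvg_cst]).
- move=> x i j; rewrite mul1r.
  have := entry_le_norm2 w i j; have := entry_le_norm2 (x - w) i j.
  have := f0 x; have := sqr_ge0 (norm2 (x - w) - 1).
  have : `|x i j| <= `|(x - w) i j| + `|w i j|.
    by rewrite !mxE -{1}(subrK (w i j) (x i j)) ler_normD.
  nra.
- by [].
Qed.

(** The objective of the proximal map is strongly convex, which improves the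
    minimality of [p] by the distance from [v] to [p]. *)
Lemma prox_ineq f w v p : convex_fun f -> (forall x, 0 <= f x) ->
  p = prox f w ->
  f p + 2^-1 * mdot (p - w) (p - w) + 2^-1 * mdot (v - p) (v - p) <=
  f v + 2^-1 * mdot (v - w) (v - w).
Proof.
move=> cf f0 pE; have pmin := prox_argmin w cf f0.
have key (s : R) : 0 < s <= 1 ->
    f p - f v - mdot (p - w) (v - p) <= s * (2^-1 * mdot (v - p) (v - p)).
  move=> /andP[s0 s1]; rewrite -(ler_pM2l s0).
  have := pmin (s *: v + (1 - s) *: p); rewrite -pE !norm2_sq.
  have -> : s *: v + (1 - s) *: p - w = (p - w) + s *: (v - p).
    by apply/matrixP => i j; rewrite !mxE; ring.
  rewrite (mdot_sqrD (p - w) (s *: (v - p))) !(mdotZr, mdotZl).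
  have := @convex_funP _ _ f s v p cf; rewrite (ltW s0) s1 => /(_ isT).
  nra.
have le0 : f p - f v - mdot (p - w) (v - p) <= 0.
  rewrite leNgt; apply/negP; set a := (X in 0 < X) => a0.
  pose b := 2^-1 * mdot (v - p) (v - p).
  have b0 : 0 <= b by rewrite mulr_ge0 ?invr_ge0 // mdot_ge0.
  have ab : a <= b by have := key 1; rewrite ltr01 lexx mul1r; apply.
  have b0' : 0 < b by apply: lt_le_trans ab.
  have s01 : 0 < a / (2 * b) <= 1.
    have b2 : 0 < 2 * b by lra.
    rewrite divr_gt0 //=.
    rewrite -(ler_pM2r b2) divfK ?lt0r_neq0 // mul1r.
    by apply: (le_trans ab); lra.
  have := key _ s01; rewrite -/a -/b.
  rewrite (_ : a / (2 * b) * b = a / 2); last by field; rewrite gt_eqF.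
  lra.
have -> : v - w = (p - w) + (v - p).
  by apply/matrixP => i j; rewrite !mxE; ring.
rewrite (mdot_sqrD (p - w) (v - p)); lra.
Qed.

(** [prox_ineq] for the linearized block problem, rescaled by [c = t / L]. *)
Lemma prox_step f (c : R) z g v p : convex_fun f -> (forall x, 0 <= f x) ->
  0 < c -> p = prox (fun y => c * f y) (z - c *: g) ->
  f p + mdot g (p - z) + (2 * c)^-1 * mdot (p - z) (p - z) <=
  f v + mdot g (v - z) +
    (2 * c)^-1 * (mdot (v - z) (v - z) - mdot (v - p) (v - p)).
Proof.
move=> cf f0 c0 pE.
have ccf := convex_fun_scale cf (ltW c0).
have := @prox_ineq (fun y => c * f y) (z - c *: g) v p ccf
  (fun x => mulr_ge0 (ltW c0) (f0 x)) pE.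
have sq a : mdot (a - (z - c *: g)) (a - (z - c *: g)) =
    mdot (a - z) (a - z) + 2 * c * mdot g (a - z) + c ^+ 2 * mdot g g.
  have -> : a - (z - c *: g) = (a - z) + c *: g.
    by apply/matrixP => i j; rewrite !mxE; ring.
  rewrite (mdot_sqrD (a - z) (c *: g)) !(mdotZr, mdotZl) (mdotC _ g); ring.
rewrite !sq -subr_ge0 => ineq.
rewrite -subr_ge0 -(pmulr_rge0 _ c0); apply: le_trans ineq _.
rewrite le_eqVlt; apply/orP; left; apply/eqP; field.
by rewrite gt_eqF.
Qed.

End Prox.

Section ArbcdRun.
Variables (R : realType) (N n : nat).
Hypothesis N_gt0 : (0 < N)%N.
Local Notation point := 'M[R]_(N, n).
Local Notation t := (arbcd_t R N).
Variables (vr : 'I_N -> 'rV[R]_n -> R) (f : point -> R) (L : 'I_N -> R).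
Hypothesis vr_convex : forall i, convex_fun (vr i).
Hypothesis vr_ge0 : forall i x, 0 <= vr i x.
Hypothesis L_gt0 : forall i, 0 < L i.
Hypothesis f_convex : forall x y, f y + mdot (grad f y) (x - y) <= f x.
Hypothesis f_block : forall i (y v : point), (forall j, j != i -> row j v = 0) ->
  f (y + v) <= f y + mdot (grad f y) v + L i / 2 * mdot v v.
Variable xs : point.
Implicit Types (z u x y : point) (h : 'I_N -> R) (l : nat) (i j : 'I_N).

Definition composite x := \sum_i vr i (row i x) + f x.

Definition iterate l z u : point := arbcd_point l.-1 z u.

(** An upper bound for [vr j] at row [j] of the iterate: it follows the convex
    combination of the [z]'s that defines the iterate. *)
Definition hat_step l z z' h : 'I_N -> R := fun j =>
  (1 - (N%:R * t l)^-1) * h j + (N%:R * t l)^-1 * vr j (row j z) +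
  (t l)^-1 * (vr j (row j z') - vr j (row j z)).

Definition step l i z u : point * point := arbcd_step vr f L l i (z, u).

(** Weight of the last [z] in the convex combination that is the iterate. *)
Definition last_weight l : R := if l is l'.+1 then (t l')^-1 else 1.

(** What is left of the iterate and of the upper bounds once the last [z] is
    taken out is a combination of the earlier [z]'s. *)
Definition run_inv l z u h :=
  (l = 0%N -> u = 0) /\
  forall j, subconv (vr j) (1 - last_weight l)
    (row j (iterate l z u) - last_weight l *: row j z)
    (h j - last_weight l * vr j (row j z)).

Definition gap2 z : R :=
  \sum_j L j * mdot (row j xs - row j z) (row j xs - row j z).

(** For [l > 0] the first coefficient is [N^2 t_{l-1}^2]. *)
Definition potential l z u h : R :=
  N%:R ^+ 2 * (t l ^+ 2 - t l / N%:R) *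
    (f (iterate l z u) + \sum_j h j - composite xs) +
  N%:R ^+ 2 / 2 * gap2 z.

Let N0 : 0 < N%:R :> R. Proof. by rewrite ltr0n. Qed.
Let t1 l : 1 <= t l. Proof. exact: arbcd_t_ge1. Qed.
Let t0 l : 0 < t l. Proof. exact: lt_le_trans (t1 l). Qed.
Let Nn : N%:R != 0 :> R. Proof. by rewrite gt_eqF. Qed.
Let tn l : t l != 0. Proof. by rewrite gt_eqF. Qed.

Lemma row_set_row i (v : 'rV[R]_n) x j :
  row j (set_row i v x) = if j == i then v else row j x.
Proof.
by apply/rowP => k; rewrite !mxE; case: eqP => // _; rewrite mxE.
Qed.

Lemma theta_le1 l : (N%:R * t l)^-1 <= 1.
Proof.
rewrite invf_le1 ?mulr_gt0 //; apply: le_trans (t1 l) _.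
by rewrite ler_pMl // ler1n.
Qed.

Lemma theta_recurrence l : 1 - (N%:R * t l.+1)^-1 = (t l / t l.+1) ^+ 2.
Proof.
have E := arbcd_tS R N_gt0 l.
have -> : (t l / t l.+1) ^+ 2 = (N%:R * t l ^+ 2) / (N%:R * t l.+1 ^+ 2).
  by field; rewrite Nn tn.
by rewrite -E; field; rewrite Nn tn.
Qed.

(** The pair [(z, u)] avoids full vector operations; in terms of the iterates the
    gradient is taken at the point of an accelerated gradient method. *)
Lemma gradient_point l z u : (l = 0%N -> u = 0) ->
  arbcd_point l z u = (1 - (N%:R * t l)^-1) *: iterate l z u +
                      (N%:R * t l)^-1 *: z.
Proof.
case: l => [/(_ erefl) ->|l _].
  by rewrite /iterate /arbcd_point scaler0 add0r -scalerDl subrK scale1r.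
rewrite /iterate /arbcd_point [l.+1.-1]/= [in RHS]scalerDr scalerA.
rewrite theta_recurrence -addrA -scalerDl -theta_recurrence subrK scale1r.
rewrite theta_recurrence; congr (_ *: _ + _); field.
by rewrite Nn !tn.
Qed.

Lemma row_arbcd_point l z u j : row j (arbcd_point l z u) =
  (1 / (N%:R * t l)) ^+ 2 *: row j u + row j z.
Proof. by rewrite /arbcd_point linearD linearZ. Qed.

(** One step moves the iterate by [N th = 1 / t] times the move of [z]. *)
Lemma row_step l i z u j :
  row j (iterate l.+1 (step l i z u).1 (step l i z u).2) =
  row j (arbcd_point l z u) + (t l)^-1 *: (row j (step l i z u).1 - row j z).
Proof.
rewrite /step /arbcd_step /iterate [l.+1.-1]/= !row_arbcd_point /=.
set p := prox _ _; rewrite !row_set_row.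
case: eqP => [->|_]; last by rewrite subrr scaler0 addr0.
by apply/rowP => k; rewrite !mxE; field; rewrite Nn tn.
Qed.

Lemma step_other l i z u j : j != i -> row j (step l i z u).1 = row j z.
Proof. by move=> /negPf ji; rewrite /step /arbcd_step /= row_set_row ji. Qed.

Lemma run_inv_step l i z u h : run_inv l z u h ->
  run_inv l.+1 (step l i z u).1 (step l i z u).2
    (hat_step l z (step l i z u).1 h).
Proof.
case=> u0 inv; split=> // j; set a := last_weight l.
set th := (N%:R * t l)^-1.
have th1 : 0 <= 1 - th <= 1.
  by rewrite subr_ge0 theta_le1 gerBl invr_ge0 mulr_ge0 // ltW.
pose b := (1 - th) * a + th - (t l)^-1.
have b0 : 0 <= b.
  rewrite /b /th /a; case: (l) => [|l'] /=; first by rewrite !mulr1 subrK invr1 subrr.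
  rewrite theta_recurrence.
  have -> : (t l' / t l'.+1) ^+ 2 * (t l')^-1 + (N%:R * t l'.+1)^-1 - (t l'.+1)^-1 =
     (N%:R * t l' - (N%:R - 1) * t l'.+1) / (N%:R * t l'.+1 ^+ 2).
    by field; rewrite Nn !tn.
  by rewrite divr_ge0 ?subr_ge0 ?arbcd_tS_le // mulr_ge0 ?exprn_ge0 // ltW.
have := subconv_scale (vr_convex j) th1 (inv j); rewrite -/a => sc.
have cE : 1 - last_weight l.+1 = (1 - th) * (1 - a) + b by rewrite /b /=; ring.
have := subconv_add (row j z) (vr_convex j) b0 _ sc.
rewrite -cE gerBl /= invr_ge0 (ltW (t0 l)) => /(_ isT).
congr (subconv _ _ _ _); last by rewrite /b /hat_step -/th; ring.
rewrite row_step; move: (row j (step l i z u).1) => w.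
rewrite gradient_point // -/th; move: (iterate l z u) => x.
by apply/rowP => k; rewrite !mxE /b /=; ring.
Qed.

Lemma composite_iterate_le l z u h : run_inv l z u h ->
  composite (iterate l z u) <= f (iterate l z u) + \sum_j h j.
Proof.
move=> [_ inv]; rewrite /composite addrC lerD2l; apply: ler_sum => j _.
have [_ /(_ (row j z))] := inv j.
by rewrite opprB addrCA subrr addr0 !subrK.
Qed.

(** The expected decrease. The proximal inequality at block [i] makes the
    distance terms cancel block by block, the mean over [i] reassembles the full
    gradient, and convexity of [f] along [z], the iterate and [xs] concludes. *)
Lemma potential_step l z u h : run_inv l z u h ->
  N%:R^-1 * \sum_i potential l.+1 (step l i z u).1 (step l i z u).2
    (hat_step l z (step l i z u).1 h) <= potential l z u h.
Proof.
case=> u0 _; set y := arbcd_point l z u; set x := iterate l z u.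
set th := (N%:R * t l)^-1; set g := grad f y.
pose base := N%:R ^+ 2 * t l ^+ 2 * (f y + (1 - th) * \sum_j h j +
  th * (\sum_j vr j (row j z)) - composite xs) + N%:R ^+ 2 / 2 * gap2 z.
have block i : potential l.+1 (step l i z u).1 (step l i z u).2
    (hat_step l z (step l i z u).1 h) <=
    base + N%:R ^+ 2 * t l * (vr i (row i xs) - vr i (row i z) +
      mdot (row i g) (row i xs - row i z)).
  set z' := (step l i z u).1; pose x' := iterate l.+1 z' (step l i z u).2.
  set p := row i z'.
  have pE : p = prox (fun v => t l / L i * vr i v)
      (row i z - (t l / L i) *: row i g).
    by rewrite /p /z' /step /arbcd_step /= row_set_row eqxx.
  have c0 : 0 < t l / L i by rewrite divr_gt0.
  have := prox_step (row i xs) (vr_convex i) (vr_ge0 i) c0 pE.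
  have -> : (2 * (t l / L i))^-1 = L i / (2 * t l).
    by field; rewrite tn gt_eqF.
  move=> pineq.
  pose v : point := set_row i ((t l)^-1 *: (p - row i z)) 0.
  have v_other j : j != i -> row j v = 0.
    by move=> /negPf ji; rewrite /v row_set_row ji linear0.
  have vi : row i v = (t l)^-1 *: (p - row i z) by rewrite row_set_row eqxx.
  have x'E : x' = y + v.
    apply/row_matrixP => j; rewrite /x' row_step -/y -/z'.
    transitivity (row j y + row j v); last by rewrite [RHS]linearD.
    congr (_ + _); have [->|ji] := eqVneq j i; first by rewrite vi.
    by rewrite v_other // /z' step_other // subrr scaler0.
  have dotv w : mdot w v = (t l)^-1 * mdot (row i w) (p - row i z).
    rewrite mdot_rows (bigD1 i) //= big1 => [|j /v_other ->]; last exact: mdot0r.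
    by rewrite addr0 vi mdotZr.
  have fineq := f_block y v_other; rewrite -x'E !dotv vi mdotZl -/g in fineq.
  have hatE : \sum_j hat_step l z z' h j = (1 - th) * (\sum_j h j) +
      th * (\sum_j vr j (row j z)) + (t l)^-1 * (vr i p - vr i (row i z)).
    rewrite /hat_step !big_split /= -!mulr_sumr; congr (_ + _ * _).
    rewrite (bigD1 i) //= big1 ?addr0 // => j ji.
    by rewrite /z' step_other // subrr.
  have gapE : gap2 z' = gap2 z -
      L i * mdot (row i xs - row i z) (row i xs - row i z) +
      L i * mdot (row i xs - p) (row i xs - p).
    rewrite /gap2 (bigD1 i) //= [in RHS](bigD1 i) //=.
    rewrite (eq_bigr (fun j => L j * mdot (row j xs - row j z) (row j xs - row j z)));
      last by move=> j ji; rewrite /z' step_other.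
    by rewrite -/p; ring.
  have qE : t l.+1 ^+ 2 - t l.+1 / N%:R = t l ^+ 2.
    have E := arbcd_tS R N_gt0 l.
    apply: (mulfI Nn); rewrite -E; field; exact: Nn.
  rewrite /potential -/x' qE hatE gapE /base.
  set d := mdot (p - row i z) (p - row i z) in pineq fineq.
  set G := mdot (row i g) (p - row i z) in pineq fineq.
  set Gs := mdot (row i g) _ in pineq *.
  set dz := mdot (row i xs - row i z) _ in pineq *.
  set dp := mdot (row i xs - p) _ in pineq *.
  have f2 : N%:R ^+ 2 * t l ^+ 2 * f x' <= N%:R ^+ 2 * t l ^+ 2 * f y +
      N%:R ^+ 2 * t l * G + N%:R ^+ 2 / 2 * L i * d.
    rewrite [leRHS](_ : _ = N%:R ^+ 2 * t l ^+ 2 *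
      (f y + (t l)^-1 * G + L i / 2 * ((t l)^-1 * ((t l)^-1 * d)))).
      by rewrite ler_pM2l // mulr_gt0 // exprn_gt0.
    by field; rewrite tn.
  have p2 : N%:R ^+ 2 * t l * vr i p + N%:R ^+ 2 * t l * G +
      N%:R ^+ 2 / 2 * L i * d <=
      N%:R ^+ 2 * t l * vr i (row i xs) + N%:R ^+ 2 * t l * Gs +
      N%:R ^+ 2 / 2 * L i * (dz - dp).
    have NT : 0 < N%:R ^+ 2 * t l by rewrite mulr_gt0 // exprn_gt0.
    have := ler_wpM2l (ltW NT) pineq.
    rewrite [X in X <= _ -> _](_ : _ = N%:R ^+ 2 * t l * vr i p +
      N%:R ^+ 2 * t l * G + N%:R ^+ 2 / 2 * L i * d); last by field; rewrite tn.
    by rewrite [X in _ <= X -> _](_ : _ = N%:R ^+ 2 * t l * vr i (row i xs) +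
      N%:R ^+ 2 * t l * Gs + N%:R ^+ 2 / 2 * L i * (dz - dp)) //;
      field; rewrite tn.
  have vE : N%:R ^+ 2 * t l ^+ 2 * ((t l)^-1 * (vr i p - vr i (row i z))) =
      N%:R ^+ 2 * t l * vr i p - N%:R ^+ 2 * t l * vr i (row i z).
    by field; rewrite tn.
  lra.
have fy : f y + th * mdot g (xs - z) <= th * f xs + (1 - th) * f x.
  have yE : y = (1 - th) *: x + th *: z by exact: gradient_point.
  have th0 : 0 <= th by rewrite invr_ge0 mulr_ge0 // ltW.
  have th1 : 0 <= 1 - th by rewrite subr_ge0 theta_le1.
  have -> : th * mdot g (xs - z) =
      th * mdot g (xs - y) + (1 - th) * mdot g (x - y).
    rewrite -!mdotZr -mdotDr; congr mdot.
    by rewrite yE; apply/matrixP => a b; rewrite !mxE; ring.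
  have := ler_wpM2l th0 (f_convex xs y); have := ler_wpM2l th1 (f_convex x y).
  rewrite -/g !mulrDr; lra.
apply: (@le_trans _ _ (N%:R^-1 * \sum_i (base + N%:R ^+ 2 * t l *
    (vr i (row i xs) - vr i (row i z) +
      mdot (row i g) (row i xs - row i z))))).
  by rewrite ler_pM2l ?invr_gt0 //; apply: ler_sum => i _; exact: block.
rewrite big_split /= sumr_const card_ord -mulr_sumr.
rewrite big_split /= sumrB.
have -> : \sum_i mdot (row i g) (row i xs - row i z) = mdot g (xs - z).
  by rewrite [RHS]mdot_rows; apply: eq_bigr => i _; rewrite linearB.
rewrite -[base *+ N]mulr_natl /potential -/x /base.
have C0 : 0 <= N%:R ^+ 2 * t l ^+ 2 by rewrite mulr_ge0 // exprn_ge0 // ltW.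
have := ler_wpM2l C0 fy.
have -> : N%:R ^+ 2 * (t l ^+ 2 - t l / N%:R) = N%:R ^+ 2 * t l ^+ 2 * (1 - th).
  by rewrite /th; field; rewrite Nn tn.
rewrite -subr_ge0 => H; rewrite -subr_ge0; apply: le_trans H _.
rewrite le_eqVlt; apply/orP; left; apply/eqP.
by rewrite /composite /th; field; rewrite Nn tn.
Qed.

Section Trajectory.
Variables (z0 : point).

Fixpoint hat (draw : nat -> 'I_N) l : 'I_N -> R :=
  if l is l'.+1 then
    hat_step l' (arbcd_state vr f L z0 draw l').1
      (arbcd_state vr f L z0 draw l).1 (hat draw l')
  else fun j => vr j (row j z0).

Definition run_potential draw l :=
  potential l (arbcd_state vr f L z0 draw l).1 (arbcd_state vr f L z0 draw l).2
    (hat draw l).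

Lemma arbcd_stateS draw l : arbcd_state vr f L z0 draw l.+1 =
  step l (draw l) (arbcd_state vr f L z0 draw l).1
    (arbcd_state vr f L z0 draw l).2.
Proof. by rewrite /= /step; case: (arbcd_state _ _ _ _ _ _). Qed.

Lemma arbcd_inv draw l :
  run_inv l (arbcd_state vr f L z0 draw l).1 (arbcd_state vr f L z0 draw l).2
    (hat draw l).
Proof.
elim: l => [|l IH].
  split=> // j; rewrite /= subrr scale1r mul1r subrr /iterate /arbcd_point.
  by rewrite scaler0 add0r subrr; exact: subconv0.
by rewrite [hat _ _]/= -/(arbcd_state vr f L z0 draw l.+1) !arbcd_stateS;
  exact: run_inv_step.
Qed.

Lemma eq_arbcd_state draw draw' l : (forall k, (k < l)%N -> draw k = draw' k) ->
  arbcd_state vr f L z0 draw l = arbcd_state vr f L z0 draw' l.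
Proof.
elim: l => // l IH E; rewrite !arbcd_stateS E // IH // => k kl.
by apply: E; rewrite ltnS ltnW.
Qed.

Lemma eq_hat draw draw' l : (forall k, (k < l)%N -> draw k = draw' k) ->
  hat draw l = hat draw' l.
Proof.
elim: l => // l IH E; rewrite [LHS]/= [RHS]/=.
rewrite -![arbcd_step _ _ _ _ _ _]/(arbcd_state vr f L z0 _ l.+1).
rewrite (eq_arbcd_state E) (@eq_arbcd_state draw draw' l) ?IH // => k kl.
  by apply: E; rewrite ltnS ltnW.
by apply: E; rewrite ltnS ltnW.
Qed.

Lemma run_potential_step draw l :
  N%:R^-1 * \sum_i run_potential (fun k => if k == l then i else draw k) l.+1 <=
  run_potential draw l.
Proof.
apply: le_trans (potential_step (arbcd_inv draw l)).
rewrite ler_pM2l ?invr_gt0 //; apply: ler_sum => i _.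
have E : forall k, (k < l)%N -> (if k == l then i else draw k) = draw k.
  by move=> k /ltn_eqF ->.
rewrite /run_potential [hat _ l.+1]/=.
rewrite -/(arbcd_state vr f L z0 (fun k => if k == l then i else draw k) l.+1).
by rewrite arbcd_stateS eqxx (eq_arbcd_state E) (eq_hat E).
Qed.

Lemma run_potential_ge draw M : (0 < M)%N ->
  N%:R ^+ 2 * t M.-1 ^+ 2 *
    (composite (arbcd vr f L z0 draw M) - composite xs) <= run_potential draw M.
Proof.
case: M => // M _; rewrite /run_potential /potential [M.+1.-1]/=.
have := composite_iterate_le (arbcd_inv draw M.+1).
set s := arbcd_state _ _ _ _ _ _; set h := hat _ _ => le.
have -> : arbcd vr f L z0 draw M.+1 = iterate M.+1 s.1 s.2.
  by rewrite /arbcd -/s; case: (s).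
have qE : t M.+1 ^+ 2 - t M.+1 / N%:R = t M ^+ 2.
  have E := arbcd_tS R N_gt0 M.
  apply: (mulfI Nn); rewrite -E; field; exact: Nn.
rewrite qE -[leLHS]addr0 lerD //.
  by rewrite ler_wpM2l ?lerB // mulr_ge0 // exprn_ge0 // ltW.
rewrite mulr_ge0 ?divr_ge0 ?exprn_ge0 //; apply: sumr_ge0 => j _.
by rewrite mulr_ge0 ?mdot_ge0 // ltW.
Qed.

Lemma run_potential0 draw : run_potential draw 0 =
  N%:R ^+ 2 * (1 - N%:R^-1) * (composite z0 - composite xs) +
  N%:R ^+ 2 / 2 * gap2 z0.
Proof.
rewrite /run_potential /potential /= expr1n div1r.
by rewrite /iterate /arbcd_point scaler0 add0r [f z0 + _]addrC.
Qed.

End Trajectory.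

End ArbcdRun.

(** * Means over finitely many uniform draws *)

Section Averages.
Variables (R : realType) (N : nat) (J : eqType).
Hypothesis N_gt0 : (0 < N)%N.
Implicit Types (v : J -> 'I_N) (g : (J -> 'I_N) -> R).

Definition upd v (j : J) (a : 'I_N) : J -> 'I_N :=
  fun k => if k == j then a else v k.

(** A conditional expectation: the coordinates in [s] are redrawn uniformly, the
    other ones keep the value they have in the argument. *)
Fixpoint avg (s : seq J) g v : R :=
  if s is j :: s' then N%:R^-1 * \sum_a avg s' g (upd v j a) else g v.

Definition agree_off (s : seq J) v v' := forall j, j \notin s -> v' j = v j.

Let N0 : 0 < N%:R :> R. Proof. by rewrite ltr0n. Qed.

Lemma upd_agree_off j (s : seq J) v a v' :
  agree_off s (upd v j a) v' -> agree_off (j :: s) v v'.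
Proof.
move=> E k; rewrite inE negb_or => /andP[kj ks].
by rewrite E // /upd (negPf kj).
Qed.

Lemma avg_cat s1 s2 g v : avg (s1 ++ s2) g v = avg s1 (avg s2 g) v.
Proof.
by elim: s1 v => //= j s1 IH v; congr (_ * _); apply: eq_bigr => a _.
Qed.

Lemma avg_le s g g' v : (forall v', agree_off s v v' -> g v' <= g' v') ->
  avg s g v <= avg s g' v.
Proof.
elim: s v => [|j s IH] v le /=; first by apply: le.
rewrite ler_pM2l ?invr_gt0 //; apply: ler_sum => a _; apply: IH => v' E.
by apply: le; exact: upd_agree_off E.
Qed.

Lemma eq_avg s g g' v : (forall v', agree_off s v v' -> g v' = g' v') ->
  avg s g v = avg s g' v.
Proof.
move=> E; apply/eqP; rewrite eq_le.
by rewrite !avg_le // => v' /E ->.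
Qed.

Lemma avg_cst s c v : avg s (fun=> c) v = c.
Proof.
elim: s v => //= j s IH v; under eq_bigr => a _ do rewrite IH.
by rewrite sumr_const card_ord -[c *+ N]mulr_natl mulKf // gt_eqF.
Qed.

Lemma avgZ s c g v : avg s (fun v => c * g v) v = c * avg s g v.
Proof.
elim: s v => //= j s IH v; under eq_bigr => a _ do rewrite IH.
by rewrite -mulr_sumr mulrCA.
Qed.

Lemma avgB s g g' v : avg s (fun v => g v - g' v) v = avg s g v - avg s g' v.
Proof.
elim: s v => //= j s IH v; under eq_bigr => a _ do rewrite IH.
by rewrite sumrB mulrBr.
Qed.

Lemma markov s (b c : R) g v : 0 < c -> (forall v', 0 <= g v') ->
  avg s g v <= c * b -> avg s (fun v' => (c < g v')%R%:R) v <= b.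
Proof.
move=> c0 g0 le; rewrite -(ler_pM2l c0) -avgZ; apply: le_trans le.
apply: avg_le => v' _; case: ltP => [/ltW|_]; rewrite ?mulr1 //.
by rewrite mulr0.
Qed.

(** Independent trials: the trial [F s] reads the coordinates [I s] and
    possibly some outside all the trials, which stay fixed. *)
Lemma avg_trials (S : eqType) (I : S -> seq J) (F : S -> (J -> 'I_N) -> bool)
    (b : R) (r : seq S) v : 0 <= b ->
  (forall (s s' : S) v v', s != s' -> agree_off (I s') v v' -> F s v' = F s v) ->
  (forall (s : S) v, avg (I s) (fun v' => (F s v')%:R) v <= b) ->
  uniq r ->
  avg (flatten [seq I s | s <- r]) (fun v' => (all (F ^~ v') r)%:R) v <=
  b ^+ size r.
Proof.
move=> b0 FI Fb; elim: r v => [|s r IH] v /=; first by rewrite expr0.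
move=> /andP[sr ur]; rewrite avg_cat.
have agreeI v1 v2 : agree_off (flatten [seq I s' | s' <- r]) v1 v2 ->
    F s v2 = F s v1.
  elim: {IH ur}r v1 v2 sr => [|s' r' IHr] v1 v2 sr E /=.
    by congr F; apply/funext => j; apply: E.
  (* [v3] undoes the changes in [I s'] only. *)
  pose v3 := fun j => if j \in I s' then v1 j else v2 j.
  move: sr; rewrite inE negb_or => /andP[ss' sr'].
  have E3 : agree_off (I s') v3 v2 by move=> j /negPf ji; rewrite /v3 ji.
  rewrite (FI s s' v3 v2) //; apply: IHr => // j jn.
  by rewrite /v3; case: ifP => // ji; apply: E; rewrite /= mem_cat ji.
apply: (@le_trans _ _ (avg (I s) (fun v' => b ^+ size r * (F s v')%:R) v)).
  apply: avg_le => v1 E1.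
  rewrite (@eq_avg _ _ (fun v' => (F s v1)%:R * (all (F ^~ v') r)%:R)).
    by rewrite avgZ mulrC ler_wpM2r // IH.
  by move=> v2 /agreeI ->; case: (F s v1); rewrite ?mul1r ?mul0r.
by rewrite avgZ exprSr ler_wpM2l ?exprn_ge0.
Qed.

Section Bridge.
Variables (d : measure_display) (T : measurableType d) (P : probability T R).
Variable draw : J -> T -> 'I_N.
Hypothesis iid : iid_uniform P draw.

Definition depends_on (s : seq J) (A : (J -> 'I_N) -> Prop) :=
  forall v v', (forall j, j \in s -> v j = v' j) -> A v -> A v'.

Lemma measurable_draws (s : seq J) v :
  measurable [set w | forall j, j \in s -> draw j w = v j].
Proof.
elim: s => [|j s IH].
  by rewrite (_ : [set _ | _] = setT) //; apply/seteqP; split.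
rewrite (_ : [set _ | _] = [set w | draw j w = v j] `&`
   [set w | forall j, j \in s -> draw j w = v j]); last first.
  apply/seteqP; split=> w /=.
    move=> H; split; first by apply: H; exact: mem_head.
    by move=> k ks; apply: H; rewrite inE ks orbT.
  by case=> H1 H2 k; rewrite inE => /orP[/eqP ->//|]; exact: H2.
by apply: measurableI => //; case: iid.
Qed.

(** The draws in [s1] are fixed to [v], which lets the induction on [s2] split the
    event along the values of one draw. *)
Lemma iid_avg_cond s1 s2 v A : uniq (s1 ++ s2) -> depends_on (s1 ++ s2) A ->
  let E := [set w | (forall j, j \in s1 -> draw j w = v j) /\
                    A (fun j => draw j w)] in
  measurable E /\
  P E = ((N%:R^-1) ^+ size s1 * avg s2 (fun v' => `[< A v' >]%:R) v)%:E.
Proof.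
elim: s2 s1 v => [|j s2 IH] s1 v un dep E.
  rewrite cats0 in un dep.
  have [Av|nAv] := pselect (A v).
    have -> : E = [set w | forall j, j \in s1 -> draw j w = v j].
      apply/seteqP; split=> w /=; first by case.
      by move=> H; split=> //; apply: dep Av => k ks; rewrite H.
    split; first exact: measurable_draws.
    by case: iid => _ -> //; rewrite /= asboolT // mulr1.
  have -> : E = set0.
    apply/seteqP; split=> w //= -[H Aw]; apply: nAv; apply: dep Aw => k ks.
    exact: H.
  by split; rewrite // measure0 /= asboolF // mulr0.
have jn : j \notin s1.
  move: un; rewrite cat_uniq => /and3P[_ /hasPn /(_ j)].
  by rewrite mem_head => /(_ isT).
pose Ea a := [set w | (forall k, k \in rcons s1 j -> draw k w = upd v j a k) /\
                      A (fun j => draw j w)].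
have HEa a := IH (rcons s1 j) (upd v j a).
have {}HEa a : measurable (Ea a) /\ P (Ea a) = ((N%:R^-1) ^+ (size s1).+1 *
    avg s2 (fun v' => `[< A v' >]%:R) (upd v j a))%:E.
  by have := HEa a; rewrite cat_rcons size_rcons; apply.
have EE : E = \big[setU/set0]_(a < N) Ea a.
  apply/seteqP; split=> w.
    case=> H Aw; rewrite -bigcup_seq; exists (draw j w); first exact: mem_index_enum.
    split=> // k; rewrite mem_rcons inE /upd; case: eqP => [->//|_] /=.
    exact: H.
  rewrite -bigcup_seq => -[a _ [H Aw]]; split=> // k ks.
  have := H k; rewrite mem_rcons inE ks orbT /upd => ->//.
  by case: eqP => // kj; move: jn; rewrite -kj ks.
rewrite EE; split; first by apply: bigsetU_measurable => a _; case: (HEa a).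
rewrite (measure_bigsetU_ord P xpredT); last 2 first.
- by move=> a; case: (HEa a).
- apply/trivIsetP => a b _ _ ab; apply/seteqP; split=> w //= -[[H1 _] [H2 _]].
  move/eqP: ab; apply; have := H1 j; have := H2 j.
  by rewrite mem_rcons mem_head /upd eqxx => /(_ isT) -> /(_ isT).
rewrite (eq_bigr (fun a => ((N%:R^-1) ^+ (size s1).+1 *
  avg s2 (fun v' => `[< A v' >]%:R) (upd v j a))%:E)); last first.
  by move=> a _; case: (HEa a).
by rewrite sumEFin -mulr_sumr exprSr mulrA.
Qed.

(** Events that read finitely many draws reduce to finite means. *)
Lemma iid_avg s v A : uniq s -> depends_on s A ->
  measurable [set w | A (fun j => draw j w)] /\
  P [set w | A (fun j => draw j w)] = (avg s (fun v' => `[< A v' >]%:R) v)%:E.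
Proof.
move=> us dep; have [/= mE PE] := @iid_avg_cond [::] s v A us dep.
have EE : [set w | (forall j, j \in [::] -> draw j w = v j) /\
                   A (fun j => draw j w)] = [set w | A (fun j => draw j w)].
  by apply/seteqP; split=> w //= [].
by rewrite EE in mE PE; split; rewrite // PE mul1r.
Qed.

End Bridge.

End Averages.

(** * Failure of one call *)

Section CallFailure.
Variables (R : realType) (N n : nat) (J : eqType).
Hypothesis N_gt0 : (0 < N)%N.
Local Notation point := 'M[R]_(N, n).
Variables (vr : 'I_N -> 'rV[R]_n -> R) (f : point -> R) (L : 'I_N -> R).
Hypothesis vr_convex : forall i, convex_fun (vr i).
Hypothesis vr_ge0 : forall i x, 0 <= vr i x.
Hypothesis L_gt0 : forall i, 0 < L i.
Hypothesis f_convex : forall x y, f y + mdot (grad f y) (x - y) <= f x.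
Hypothesis f_block : forall i (y v : point), (forall j, j != i -> row j v = 0) ->
  f (y + v) <= f y + mdot (grad f y) v + L i / 2 * mdot v v.
Variables (xs z0 : point) (c : nat -> J).
Hypothesis xs_min : is_argmin (composite vr f) xs.
Hypothesis c_inj : injective c.

Let start_gap := composite vr f z0 - composite vr f xs + gap2 L xs z0.

Lemma mean_potential M (v : J -> 'I_N) :
  avg (mkseq c M)
    (fun v => run_potential vr f L xs z0 (fun l => v (c l)) M) v <=
  N%:R ^+ 2 * (1 - N%:R^-1) * (composite vr f z0 - composite vr f xs) +
  N%:R ^+ 2 / 2 * gap2 L xs z0.
Proof.
elim: M => [|M IH]; first by rewrite /= run_potential0.
rewrite mkseqS -cats1 avg_cat; apply: le_trans IH; apply: (avg_le N_gt0) => v' _ /=.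
apply: le_trans (run_potential_step N_gt0 vr_convex vr_ge0 L_gt0 f_convex f_block
  xs z0 (fun l => v' (c l)) M).
rewrite le_eqVlt; apply/orP; left; apply/eqP; congr (_ * _).
apply: eq_bigr => a _; congr run_potential; apply/funext => k.
by rewrite /upd (inj_eq c_inj).
Qed.

(** The mean suboptimality after [M] iterations is at most [4 N^2 / M^2] times the
    initial gap, since [N t] is at least [M / 2]; the factor 8 makes it at most
    [a / 2], and Markov's inequality applies. *)
Lemma call_failure M (a : R) (v : J -> 'I_N) : (0 < M)%N -> 0 < a ->
  8 * N%:R ^+ 2 * start_gap <= a * M%:R ^+ 2 ->
  avg (mkseq c M) (fun v => (a <
    composite vr f (arbcd vr f L z0 (fun l => v (c l)) M) -
    composite vr f xs)%R%:R) v <= 2^-1 :> R.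
Proof.
move=> M0 a0 aM; apply: (markov N_gt0) => // [v'|]; first by rewrite subr_ge0 xs_min.
have N0 : 0 < N%:R :> R by rewrite ltr0n.
have N1 : 1 <= N%:R :> R by rewrite ler1n.
have Mp : 0 < M%:R :> R by rewrite ltr0n.
have tM : M%:R <= 2 * N%:R * arbcd_t R N M.-1.
  have := arbcd_t_ge R N_gt0 M.-1.
  rewrite -(ler_pM2l (mulr_gt0 (ltr0Sn R 1) N0)); apply: le_trans.
  rewrite mulrDr mulr1 mulrCA divff ?mulr1; last by rewrite mulf_neq0 // gt_eqF.
  have : M%:R = M.-1%:R + 1 :> R by rewrite natr1 prednK.
  lra.
pose K : R := N%:R ^+ 2 * arbcd_t R N M.-1 ^+ 2.
have KM : M%:R ^+ 2 <= 4 * K.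
  have -> : 4 * K = (2 * N%:R * arbcd_t R N M.-1) ^+ 2 by rewrite /K; ring.
  by rewrite ler_pXn2r // nnegrE ltW // (lt_le_trans Mp).
have M20 : 0 < M%:R ^+ 2 :> R by rewrite exprn_gt0.
have K0 : 0 < K by lra.
have := mean_potential M v.
set W := (X in _ <= X) => mean.
have W_le : W <= N%:R ^+ 2 * start_gap.
  rewrite /W /start_gap [leRHS]mulrDr lerD //.
    by rewrite ler_wpM2r ?subr_ge0 ?xs_min // ler_piMr ?exprn_ge0 //.
  rewrite ler_wpM2r //.
    by apply: sumr_ge0 => j _; rewrite mulr_ge0 ?mdot_ge0 // ltW.
  by rewrite ler_pdivrMr // ler_peMr ?exprn_ge0 // ler1n.
rewrite -(ler_pM2l K0) -avgZ.
apply: (@le_trans _ _ W).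
  apply: le_trans mean; apply: (avg_le N_gt0) => v' _.
  exact: run_potential_ge.
apply: (le_trans W_le).
have := ler_wpM2l (ltW a0) KM; lra.
Qed.

End CallFailure.

(** * Successful runs of the augmented Lagrangian method *)

Section Extension.
Variables (R : realType) (N n r : nat) (D : dfal_data R N n r).
Hypothesis argmin_ex : forall k th, exists x, is_argmin (augmented D k th) x.
Local Notation point := 'M[R]_(N, n).
Implicit Types (x y : nat -> point) (k j : nat).

Lemma eq_theta_succ x y k : (forall j, (0 < j <= k)%N -> x j = y j) ->
  theta_succ D x k = theta_succ D y k.
Proof.
elim: k => //= k IH E; rewrite IH => [|j /andP[j0 jk]].
  by rewrite E //= leqnn.
by apply: E; rewrite j0 ltnW.
Qed.

Lemma eq_theta x y k : (forall j, (0 < j < k)%N -> x j = y j) ->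
  theta D x k = theta D y k.
Proof.
case: k => [|k] E; apply: eq_theta_succ => j /andP[j0 jk].
  by have := leq_trans j0 jk.
by apply: E; rewrite j0.
Qed.

Lemma eq_Pk x y k : (forall j, (0 < j < k)%N -> x j = y j) -> Pk D x k = Pk D y k.
Proof. by move=> E; rewrite /Pk (eq_theta E). Qed.

Lemma eq_cond_a x y k : (0 < k)%N -> (forall j, (0 < j <= k)%N -> x j = y j) ->
  cond_a D x k -> cond_a D y k.
Proof.
move=> k0 E [xs xsm le]; have P : Pk D x k = Pk D y k.
  by apply: eq_Pk => j /andP[j0 /ltnW jk]; apply: E; rewrite j0.
by exists xs; rewrite -?P // -E // k0 leqnn.
Qed.

Lemma eq_cond_b x y k : (0 < k)%N -> (forall j, (0 < j <= k)%N -> x j = y j) ->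
  cond_b D x k -> cond_b D y k.
Proof.
move=> k0 E; have Ek : x k = y k by apply: E; rewrite k0 /=.
have Et : theta D x k = theta D y k.
  by apply: eq_theta => j /andP[j0 /ltnW jk]; apply: E; rewrite j0.
by case=> g gP; exists g => i; rewrite -Et -Ek.
Qed.

(** Free of the choice of a minimizer, hence suitable for measurability. *)
Lemma cond_aE x k : cond_a D x k <->
  forall y : point, Pk D x k (x k) - Pk D x k y <= alpha D k.
Proof.
split=> [[xs xsm le] y|H].
  by apply: le_trans le; rewrite lerB.
by have [xs xsm] := argmin_ex k (theta D x k); exists xs => //; exact: H.
Qed.

Definition good_until x (K : nat) :=
  forall k, (0 < k <= K)%N -> cond_a D x k \/ cond_b D x k.

(** The assumptions on the method speak of infinite runs; exact minimizers meet
    the first condition and so complete a finite run. *)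
Lemma extend_run x K : 0 <= alpha1 D -> 0 <= cfac D -> good_until x K ->
  exists y, dfal_sequence D y /\ forall j, (0 < j <= K)%N -> y j = x j.
Proof.
move=> a0 c0 good.
pose next k th := if (k <= K)%N then x k
  else xget 0 [set z | is_argmin (augmented D k th) z].
pose ext := fix ext k : point * 'cV[R]_r := if k is j.+1 then
  let th := (ext j).2 in (next k th, next_theta D k th (next k th)) else (x 0, 0).
pose y k := (ext k).1.
have yth k : theta_succ D y k = (ext k).2.
  by elim: k => //= k ->.
exists y; split; last by case=> // j /andP[_ jK]; rewrite /y /= /next jK.
case=> // k _; have [kK|Kk] := leqP k.+1 K.
  have E j : (0 < j <= k.+1)%N -> x j = y j.
    by case: j => // j /andP[_ jk]; rewrite /y /= /next (leq_trans jk).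
  by have [] := good k.+1 kK; [left; apply: eq_cond_a E _ | right; apply: eq_cond_b E _].
left; have [xs xsm] := argmin_ex k.+1 (theta D y k.+1).
have ym : is_argmin (Pk D y k.+1) (y k.+1).
  rewrite /Pk {2}/y /= /next leqNgt Kk /= /theta [k.+1.-1]/= yth.
  by case: xgetP => [z -> //|]; rewrite /theta [k.+1.-1]/= yth in xsm => /(_ xs).
by exists (y k.+1) => //; rewrite subrr /alpha mulr_ge0 // exprn_ge0 // exprn_ge0.
Qed.

Lemma good_bounds x K Bx Bth : 0 <= alpha1 D -> 0 <= cfac D ->
  dfal_bounds D Bx Bth -> good_until x K ->
  [/\ forall k, (0 < k <= K)%N -> norm2 (x k) <= Bx,
      forall xs, is_argmin (Pk D x K.+1) xs -> norm2 xs <= Bx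
    & norm2 (theta D x K.+1) <= Bth].
Proof.
move=> a0 c0 bnd good; have [y [yd yE]] := extend_run a0 c0 good.
have thE : theta D y K.+1 = theta D x K.+1 by apply: eq_theta => j; exact: yE.
split.
- by move=> k kK; rewrite -yE //; have [] := bnd y yd k; case/andP: kK.
- by move=> xs; have [+ _ _] := bnd y yd K.+1 isT; rewrite /Pk thE; apply.
- by rewrite -thE; have [] := bnd y yd K.+1 isT.
Qed.

Lemma Neps_ge Cbar eps : log_inv_c D (Cbar / eps) <= (Neps D Cbar eps)%:R.
Proof.
rewrite /Neps; set a := log_inv_c _ _; set m := Num.max 0 _.
have m0 : 0 <= m by rewrite le_max lexx.
apply: (@le_trans _ _ (`|m|%N%:R)); last by rewrite ler_nat leq_maxr.
rewrite natr_absz ger0_norm //; apply: le_trans (ceil_ge _) _.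
by rewrite ler_int le_max lexx orbT.
Qed.

Lemma good_eps_solution (e : rel 'I_N) x (Fstar Cbar eps : R) :
  (forall (x : point) (i j : 'I_N), e i j ->
     norm2 (row i x - row j x) <= norm2 (Amx D *m stack x)) ->
  0 <= alpha1 D -> 0 <= cfac D -> dfal_rate D Fstar Cbar -> 0 < eps ->
  good_until x (Neps D Cbar eps) ->
  eps_solution D e Fstar eps (x (Neps D Cbar eps)).
Proof.
move=> gap a0 c0 rate eps0 good; set K := Neps D Cbar eps.
have K0 : (0 < K)%N by rewrite /K /Neps leq_maxl.
have [y [yd yE]] := extend_run a0 c0 good.
have [] := rate y yd eps eps0 K K0 (Neps_ge _ _).
rewrite yE ?K0 ?leqnn // => Ale Fle; split=> // i j eij.
exact: le_trans (gap _ _ _ eij) Ale.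
Qed.

End Extension.

(** * Measurability *)



Section Measurability.
Context {d : measure_display} {T : measurableType d} {R : realType}.

Lemma measurable_exists (I : countType) (F : I -> set T) :
  (forall i, measurable (F i)) -> measurable [set w | exists i, F i w].
Proof.
move=> mF; rewrite (_ : [set _ | _] = \bigcup_i F i).
  by apply: countable_bigcupT_measurable => //; exact: countableP.
by apply/seteqP; split=> w [i]; [exists i | move=> _ Fi; exists i].
Qed.

Lemma measurable_forall (I : countType) (F : I -> set T) :
  (forall i, measurable (F i)) -> measurable [set w | forall i, F i w].
Proof.
move=> mF; rewrite (_ : [set _ | _] = ~` [set w | exists i, (~` F i) w]).
  by apply/measurableC/measurable_exists => i; exact: measurableC.
apply/seteqP; split=> w /= H; first by case=> i; apply.
by move=> i; apply: contrapT => Fi; apply: H; exists i.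
Qed.

Lemma measurable_le_set (f g : T -> R) : measurable_fun setT f ->
  measurable_fun setT g -> measurable [set w | f w <= g w].
Proof. by move=> mf mg; rewrite -[X in measurable X]setTI; exact: measurable_fun_le. Qed.

Lemma measurable_lt_set (f g : T -> R) : measurable_fun setT f ->
  measurable_fun setT g -> measurable [set w | f w < g w].
Proof.
move=> mf mg; rewrite (_ : [set _ | _] = ~` [set w | g w <= f w]).
  by apply/measurableC/measurable_le_set.
by apply/seteqP; split=> w /=; rewrite ltNge; move/negP.
Qed.

Lemma rat_matrix_approx m n (x : 'M[R]_(m, n)) (e : R) : 0 < e ->
  exists q : 'M[rat]_(m, n), forall i j, `|x i j - ratr (q i j)| < e.
Proof.
move=> e0; have ex i j : exists q : rat, `|x i j - ratr q| < e.
  have lt : x i j - e < x i j + e by lra.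
  have [q] := rat_in_itvoo lt; rewrite inE /= => /itvP h.
  by exists q; rewrite distrC ltr_distl !h.
exists (\matrix_(i, j) xget 0 [set q | `|x i j - ratr q| < e]) => i j.
by rewrite mxE; case: xgetP => [q -> //|none]; have [q /none] := ex i j.
Qed.

(** Rational boxes form a countable base, so coordinatewise measurability is
    enough. *)
Lemma measurable_continuous_mx m n (F : 'M[R]_(m, n) -> R)
    (X : T -> 'M[R]_(m, n)) : continuous F ->
  (forall i j, measurable_fun setT (fun w => X w i j)) ->
  measurable_fun setT (fun w => F (X w)).
Proof.
move=> cF mX mT; apply: (measurability _ (RGenOInfty.measurableE R)) => //.
move=> /= _ [_ [a ->] <-]; rewrite preimage_itvoy setTI.
pose inbox (p : 'M[rat]_(m, n) * nat) (y : 'M[R]_(m, n)) :=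
  forall i j, `|y i j - ratr (p.1 i j)| < p.2.+1%:R^-1.
pose good p := forall y, inbox p y -> a < F y.
rewrite (_ : [set _ | _] = [set w | exists p, (fun p =>
    if `[< good p >] then [set w | inbox p (X w)] else set0) p w]).
  apply: measurable_exists => p; case: asboolP => _; last exact: measurable0.
  apply: measurable_forall => i; apply: measurable_forall => j.
  apply: measurable_lt_set => //.
  apply: measurableT_comp => //.
  by apply: measurable_funB; [exact: mX | exact: measurable_cst].
apply/seteqP; split=> w /=; last first.
  by case=> p; case: asboolP => // gp /gp.
move=> aF; have /nbhs_ballP[e /= e0 eP] : nbhs (X w) [set y | a < F y].
  by have FF := nbhs_filter (X w); exact: (cvgr_gt (F (X w)) (cF (X w)) _ aF).
have [k ke] : exists k, k.+1%:R^-1 < e / 2.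
  have e20 : 0 < e / 2 by rewrite divr_gt0.
  have [k _ /(_ k (leqnn k))] := near_infty_natSinv_lt (PosNum e20).
  by exists k.
have k0 : 0 < k.+1%:R^-1 :> R by rewrite invr_gt0.
have [q qP] := rat_matrix_approx (X w) k0.
exists (q, k); case: asboolP => [_ //|]; apply => y yin; apply: eP.
split=> // i j; rewrite /ball /=.
have := yin i j; have := qP i j.
have := ler_distD (ratr (q i j)) (X w i j) (y i j).
rewrite /= (distrC (ratr (q i j)) (y i j)) => h1 h2 h3.
by apply: le_lt_trans h1 _; rewrite [e]splitr ltrD // (lt_trans _ ke).
Qed.

Section DfalEvents.
Variables (N n r : nat) (D : dfal_data R N n r).
Hypothesis rho_cont : forall i, continuous (rho D i).
Hypothesis gam_cont : forall i, continuous (gam D i).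
Hypothesis aug_cont : forall k th, continuous (augmented D k th).
Hypothesis argmin_ex : forall k th, exists x, is_argmin (augmented D k th) x.
Local Notation point := 'M[R]_(N, n).

Lemma measurable_mx_stack q (M : 'M[R]_(q, N * n)) (X : T -> point) i j :
  (forall i j, measurable_fun setT (fun w => X w i j)) ->
  measurable_fun setT (fun w => (M *m stack (X w)) i j).
Proof.
by move=> mX; apply: (@measurable_continuous_mx _ _
  (fun x : point => (M *m stack x) i j)) => //; exact: continuous_mx_stack.
Qed.

Lemma measurable_theta_succ (x : nat -> T -> point) k i j :
  (forall l i j, (0 < l <= k)%N -> measurable_fun setT (fun w => x l w i j)) ->
  measurable_fun setT (fun w => theta_succ D (fun l => x l w) k i j).
Proof.
elim: k i j => [|k IH] i j mx /=; first by apply: measurable_cst.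
rewrite (_ : (fun w => _) = (fun w => theta_succ D (fun l => x l w) k i j -
    (lam D k.+1)^-1 * (Amx D *m stack (x k.+1 w)) i j)); last first.
  by apply/funext => w; rewrite /next_theta !mxE.
apply: measurable_funB.
  by apply: IH => l i' j' /andP[l0 lk]; apply: mx; rewrite l0 ltnW.
apply: measurable_funM => //; apply: measurable_mx_stack => i' j'.
by apply: mx; rewrite leqnn.
Qed.

Lemma measurable_sum_rows (F : 'I_N -> 'rV[R]_n -> R) (X : T -> point) :
  (forall i, continuous (F i)) ->
  (forall i j, measurable_fun setT (fun w => X w i j)) ->
  measurable_fun setT (fun w => \sum_i F i (row i (X w))).
Proof.
move=> cF mX; apply: (@measurable_continuous_mx _ _
  (fun x : point => \sum_i F i (row i x))) => //.
apply: continuous_sum => i x.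
by apply: continuous_comp; [exact: continuous_row | exact: cF].
Qed.

Lemma measurable_augmented k (th : T -> 'cV[R]_r) (X : T -> point) :
  (forall i j, measurable_fun setT (fun w => th w i j)) ->
  (forall i j, measurable_fun setT (fun w => X w i j)) ->
  measurable_fun setT (fun w => augmented D k (th w) (X w)).
Proof.
move=> mth mX; rewrite /augmented /smooth_part.
apply: measurable_funD; first by apply: measurable_funM => //; exact: measurable_sum_rows.
apply: measurable_funD; first by apply: measurable_funM => //; exact: measurable_sum_rows.
apply: measurable_funM => //.
rewrite (_ : (fun w => _) = (fun w => \sum_i
    ((Amx D *m stack (X w)) i 0 - lam D k * th w i 0) *
    ((Amx D *m stack (X w)) i 0 - lam D k * th w i 0))); last first.
  by apply/funext => w; rewrite norm2_sq mdot_cV; apply: eq_bigr => i _; rewrite !mxE.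
apply: measurable_sum => i.
have m1 : measurable_fun setT
    (fun w => (Amx D *m stack (X w)) i 0 - lam D k * th w i 0).
  apply: measurable_funB; first exact: measurable_mx_stack.
  exact: measurable_funM.
exact: (measurable_funM m1 m1).
Qed.

(** By continuity it is enough to compare with rational points, which leaves a
    countable intersection. *)
Lemma measurable_success (x : nat -> T -> point) k : (0 < k)%N ->
  (forall l i j, (0 < l <= k)%N -> measurable_fun setT (fun w => x l w i j)) ->
  measurable (success D x k).
Proof.
move=> k0 mx.
have mth i j : measurable_fun setT (fun w => theta D (fun l => x l w) k i j).
  apply: measurable_theta_succ => l i' j' /andP[l0 lk].
  by apply: mx; rewrite l0 (leq_trans lk) // leq_pred.
rewrite (_ : success D x k = [set w | forall q : 'M[rat]_(N, n),
    Pk D (fun l => x l w) k (x k w) - alpha D k <=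
    Pk D (fun l => x l w) k (map_mx ratr q)]).
  apply: measurable_forall => q; apply: measurable_le_set.
    apply: measurable_funB => //; apply: measurable_augmented => // i j.
    by apply: mx; rewrite k0 leqnn.
  by apply: measurable_augmented.
apply/seteqP; split=> w; rewrite /success /=.
  by move=> /(cond_aE argmin_ex) H q; rewrite lerBlDr -lerBlDl.
move=> H; apply/(cond_aE argmin_ex) => y; rewrite lerBlDl -lerBlDr.
rewrite leNgt; apply/negP => lt.
have /nbhs_ballP[e /= e0 eP] : nbhs y [set z |
    Pk D (fun l => x l w) k z < Pk D (fun l => x l w) k (x k w) - alpha D k].
  have FF := nbhs_filter y; pose G := Pk D (fun l => x l w) k.
  have cG : continuous G := @aug_cont _ _.
  exact: (cvgr_lt (G y) (cG y) _ lt).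
have [q qP] := rat_matrix_approx y e0.
have : ball y e (map_mx ratr q) by split=> // i j; rewrite /ball /= mxE.
by move=> /eP /=; rewrite ltNge H.
Qed.

Lemma measurable_past_success (x : nat -> T -> point) useb k :
  (forall l i j, (0 < l < k)%N -> measurable_fun setT (fun w => x l w i j)) ->
  measurable (past_success D useb x k).
Proof.
move=> mx; rewrite /past_success.
apply: measurable_forall => j.
have [/andP[/andP[j0 jk] nb]|nj] := boolP ((0 < j < k)%N && ~~ useb j).
  rewrite [X in measurable X](_ : _ = success D x j).
    apply: measurable_success => // l i' j' /andP[l0 lj]; apply: mx.
    by rewrite l0 (leq_ltn_trans lj).
  by apply/seteqP; split=> w /= H; [apply: H; rewrite ?j0 | move=> _ _].
rewrite [X in measurable X](_ : _ = setT) //; apply/seteqP; split=> w //= _ jk nb.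
by rewrite jk nb in nj.
Qed.

Lemma measurable_eps_solution (e : rel 'I_N) (X : T -> point) (Fstar eps : R) :
  (forall i j, measurable_fun setT (fun w => X w i j)) ->
  measurable [set w | eps_solution D e Fstar eps (X w)].
Proof.
move=> mX; rewrite /eps_solution; apply: measurableI.
  apply: measurable_le_set => //; apply: measurableT_comp => //.
  apply: measurable_funB => //.
  rewrite (_ : (fun w => _) = (fun w => \sum_i rho D i (row i (X w)) +
      \sum_i gam D i (row i (X w)))); last first.
    by apply/funext => w; rewrite /Fbar big_split.
  by apply: measurable_funD; exact: measurable_sum_rows.
apply: measurable_forall => i; apply: measurable_forall => j.
case: (e i j); last first.
  by rewrite [X in measurable X](_ : _ = setT) //; apply/seteqP; split.
rewrite [X in measurable X](_ : _ = [set w |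
    \sum_k (X w i k - X w j k) * (X w i k - X w j k) <= eps ^+ 2] `&`
    [set w | 0 <= eps]).
  apply: measurableI; last exact: measurable_le_set.
  apply: measurable_le_set => //; apply: measurable_sum => k.
  have m1 : measurable_fun setT (fun w => X w i k - X w j k).
    exact: measurable_funB.
  exact: (measurable_funM m1 m1).
have E w : mdot (row i (X w) - row j (X w)) (row i (X w) - row j (X w)) =
    \sum_k (X w i k - X w j k) * (X w i k - X w j k).
  by rewrite mdot_rV; apply: eq_bigr => k _; rewrite !mxE.
apply/seteqP; split=> w /=.
  move=> /(_ isT) H; have e0 := le_trans (norm2_ge0 _) H.
  by split=> //; rewrite -E -norm2_le.
by move=> [H e0] _; rewrite norm2_le // E.
Qed.

(** The conditional bounds multiply up to the joint probability of success. *)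
Lemma past_success_ge (P : probability T R) useb (x : nat -> T -> point)
    (q : nat -> R) K :
  (forall k, (0 < k <= K)%N -> 0 <= q k) ->
  (forall k, (0 < k <= K)%N -> ~~ useb k ->
    ((q k)%:E * P (past_success D useb x k) <=
     P (success D x k `&` past_success D useb x k))%E) ->
  ((\prod_(1 <= k < K.+1 | ~~ useb k) q k)%:E <=
   P (past_success D useb x K.+1))%E.
Proof.
elim: K => [|K IH] q0 H.
  rewrite big_geq // (_ : past_success _ _ _ _ = setT) ?probability_setT //.
  by apply/seteqP; split=> w //= _ [|j].
have {}IH : ((\prod_(1 <= k < K.+1 | ~~ useb k) q k)%:E <=
   P (past_success D useb x K.+1))%E.
  by apply: IH => k /andP[k0 kK]; [apply: q0 | apply: H]; rewrite k0 ltnW.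
have [nb|ub] := boolP (~~ useb K.+1); last first.
  rewrite big_mkcond big_nat_recr //= (negPf ub) mulr1 -big_mkcond /=.
  rewrite (_ : past_success _ _ _ K.+2 = past_success D useb x K.+1) //.
  apply/seteqP; split=> w /= pw j /andP[j0]; rewrite ltnS.
    by move=> jK; apply: pw; rewrite j0 ltnS ltnW.
  rewrite leq_eqVlt => /orP[/eqP -> nb|jK]; first by rewrite nb in ub.
  by apply: pw; rewrite j0.
rewrite big_mkcond big_nat_recr //= nb -big_mkcond /= mulrC EFinM.
have := H K.+1 (leqnn _) nb.
rewrite (_ : _ `&` _ = past_success D useb x K.+2); last first.
  apply/seteqP; split=> w /=.
    case=> s pw j /andP[j0]; rewrite ltnS leq_eqVlt => /orP[/eqP -> //|jK].
    by apply: pw; rewrite j0.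
  move=> pw; split; first by apply: pw; rewrite /= ?ltnSn.
  by move=> j /andP[j0 jK]; apply: pw; rewrite j0 ltnW.
by apply: le_trans; rewrite lee_wpmul2l // lee_fin q0 /= ?leqnn.
Qed.

End DfalEvents.

End Measurability.

(** * Randomized iterations of the augmented Lagrangian method *)

Section RandomizedRun.
Variables (R : realType) (N n r : nat) (e : rel 'I_N) (D : dfal_data R N n r).
Variables (U : 'M[R]_(#|edges e| * n, r)) (s : 'rV[R]_r) (V : 'M[R]_(N * n, r)).
Variables (Lgam lbgam B tau : 'I_N -> R) (Bx Btheta : R).
Local Notation point := 'M[R]_(N, n).
Variable x0 : point.
Hypothesis N_gt0 : (0 < N)%N.
Hypothesis syme : symmetric e.
Hypothesis svd : reduced_svd (consensus_mx R e n) U s V.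
Hypothesis A_def : Amx D = diag_mx s *m V^T.
Hypothesis gamP : forall i, class_Gamma (gam D i) (Lgam i) (lbgam i).
Hypothesis rhoP : forall i, class_R (rho D i) (B i) (tau i).
Hypothesis c01 : 0 < cfac D < 1.
Hypothesis lam1_gt0 : 0 < lam1 D.
Hypothesis alpha1_gt0 : 0 < alpha1 D.
Hypothesis L_gt0 : forall i, 0 < Lgam i + (degree e i)%:R.
Hypothesis Bx_gt0 : 0 < Bx.
Hypothesis Btheta_gt0 : 0 < Btheta.
Hypothesis bounds : dfal_bounds D Bx Btheta.

Let c0 : 0 < cfac D. Proof. by case/andP: c01. Qed.
Let c1 : cfac D < 1. Proof. by case/andP: c01. Qed.

Lemma lam_gt0 k : 0 < lam D k.
Proof. by rewrite /lam mulr_gt0 // exprn_gt0. Qed.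

Lemma lam_le k : lam D k <= lam1 D.
Proof.
by apply: ler_piMl; [exact: ltW | apply: exprn_ile1; exact: ltW].
Qed.

Lemma alpha_gt0 k : 0 < alpha D k.
Proof. by rewrite /alpha mulr_gt0 // !exprn_gt0. Qed.

Definition block_const k i := lam D k * Lgam i + (degree e i)%:R.

Lemma block_const_gt0 k i : 0 < block_const k i.
Proof.
have L0 : 0 <= Lgam i by case: (gamP i) => _ _ [].
have := L_gt0 i; rewrite /block_const.
have [->|d0] := posnP (degree e i).
  by rewrite !addr0 => ?; rewrite mulr_gt0 // lam_gt0.
by move=> _; rewrite ltr_wpDl ?ltr0n // mulr_ge0 // ltW // lam_gt0.
Qed.

Lemma composite_augmented k th x :
  composite (fun i y => lam D k * rho D i y) (smooth_part D k th) x =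
  augmented D k th x.
Proof. by rewrite /composite /augmented mulr_sumr. Qed.

Definition radius := Num.max Bx (norm2 x0).

(** The bounds on iterates, multipliers and minimizers, with [lam k <= lam1], give
    one constant in the rate of the calls of all the iterations. *)
Lemma uniform_start_gap : exists2 W : R, 0 < W &
  forall k (th : 'cV[R]_r) (z xs : point), norm2 th <= Btheta ->
    norm2 z <= radius -> norm2 xs <= Bx ->
    augmented D k th z - augmented D k th xs + gap2 (block_const k) xs z <= W.
Proof.
have r0 : 0 < radius by rewrite lt_max Bx_gt0.
have ball (F : 'I_N -> 'rV[R]_n -> R) : (forall i, continuous (F i)) ->
    exists M, forall x : point, norm2 x <= radius ->
      \sum_i F i (row i x) <= M.
  move=> cF; have /choice[M MP] : forall i, exists M, forall y,
      norm2 y <= radius -> F i y <= M.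
    by move=> i; apply: continuous_bounded_ball; exact: cF.
  exists (\sum_i M i) => x xr; apply: ler_sum => i _; apply: MP.
  rewrite norm2_le ?(ltW r0) //; apply: le_trans (mdot_row_le _ _) _.
  by rewrite -norm2_le ?(ltW r0).
have [Mr MrP] := ball _ (rho_continuous rhoP).
have [Mg MgP] := ball _ (gam_continuous gamP).
pose Q := radius ^+ 2.
pose E : R := (4 * #|edges e|)%:R.
pose W := lam1 D * `|Mr + Mg| + E * Q + lam1 D ^+ 2 * Btheta ^+ 2 +
  lam1 D * `|\sum_i lbgam i| + \sum_i (lam1 D * Lgam i + (degree e i)%:R) * (4 * Q).
exists (`|W| + 1); first by rewrite ltr_wpDl.
move=> k th z xs thB zB xsB.
have z2 : mdot z z <= Q by rewrite -norm2_le ?(ltW r0).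
have xs2 : mdot xs xs <= Q.
  by rewrite -norm2_le ?(ltW r0) //; apply: le_trans xsB _; rewrite le_max lexx.
have th2 : mdot th th <= Btheta ^+ 2 by rewrite -norm2_le // ltW.
have lam0 := lam_gt0 k.
suff : augmented D k th z - augmented D k th xs + gap2 (block_const k) xs z <= W.
  by move/le_trans; apply; rewrite (le_trans (ler_norm W)) // lerDl.
have up : augmented D k th z <=
    lam1 D * `|Mr + Mg| + E * Q + lam1 D ^+ 2 * Btheta ^+ 2.
  rewrite /augmented /smooth_part addrA -mulrDr -addrA; apply: lerD.
    apply: (@le_trans _ _ (lam D k * `|Mr + Mg|)).
      rewrite ler_pM2l // (le_trans _ (ler_norm _)) //.
      by rewrite lerD ?MrP ?MgP.
    by rewrite ler_wpM2r // lam_le.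
  rewrite norm2_sq.
  have := mdot_sub_le2 (Amx D *m stack z) (lam D k *: th).
  have -> : mdot (lam D k *: th) (lam D k *: th) = lam D k ^+ 2 * mdot th th.
    by rewrite mdotZl mdotZr mulrA expr2.
  move=> h.
  have h1 : mdot (Amx D *m stack z) (Amx D *m stack z) <= E * Q.
    by apply: le_trans (penalty_le svd A_def z) _; rewrite ler_wpM2l.
  have h2 : lam D k ^+ 2 * mdot th th <= lam1 D ^+ 2 * Btheta ^+ 2.
    apply: ler_pM => //; [by rewrite exprn_ge0 // ltW | exact: mdot_ge0 |].
    by rewrite ler_pXn2r ?lam_le // nnegrE ltW.
  rewrite mulrC ler_pdivrMr //; lra.
have low : - (lam1 D * `|\sum_i lbgam i|) <= augmented D k th xs.
  apply: le_trans (augmented_ge gamP rhoP lam_gt0 k th xs).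
  apply: (@le_trans _ _ (- (lam D k * `|\sum_i lbgam i|))).
    by rewrite lerN2 ler_wpM2r // lam_le.
  by rewrite -mulrN ler_pM2l // lerNl -normrN ler_norm.
have gap : gap2 (block_const k) xs z <=
    \sum_i (lam1 D * Lgam i + (degree e i)%:R) * (4 * Q).
  apply: ler_sum => i _.
  have L0 : 0 <= Lgam i by case: (gamP i) => _ _ [].
  apply: ler_pM; rewrite ?mdot_ge0 ?(ltW (block_const_gt0 _ _)) //.
    by rewrite lerD2r ler_wpM2r // lam_le.
  apply: le_trans (mdot_sub_le2 _ _) _.
  have := mdot_row_le i xs; have := mdot_row_le i z; lra.
rewrite /W; lra.
Qed.

Section Calls.
Variables (calls iters : nat -> nat) (W : R).
Hypothesis calls_gt0 : forall k, (0 < k)%N -> (0 < calls k)%N.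
Hypothesis iters_gt0 : forall k, (0 < k)%N -> (0 < iters k)%N.
Hypothesis W_bound : forall k (th : 'cV[R]_r) (z xs : point),
  norm2 th <= Btheta -> norm2 z <= radius -> norm2 xs <= Bx ->
  augmented D k th z - augmented D k th xs + gap2 (block_const k) xs z <= W.
Hypothesis iters_large : forall k, (0 < k)%N ->
  8 * N%:R ^+ 2 * W <= alpha D k * (iters k)%:R ^+ 2.
Notation J := (nat * nat * nat)%type.
Implicit Types v : J -> 'I_N.

Let run v := arbcd_dfal D e Lgam x0 calls iters v.

Definition call_draws k m : seq J := mkseq (fun l => (k, m, l)) (iters k).

Definition iteration_draws k : seq J :=
  flatten [seq call_draws k m | m <- iota 0 (calls k)].

Fixpoint all_draws K : seq J :=
  if K is K'.+1 then all_draws K' ++ iteration_draws K else [::].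

Lemma call_drawsE k m j :
  (j \in call_draws k m) = [&& j.1.1 == k, j.1.2 == m & (j.2 < iters k)%N].
Proof.
apply/mapP/and3P => [[l]|[/eqP jk /eqP jm jl]].
  by rewrite mem_iota /= => lk -> /=; rewrite !eqxx.
exists j.2; first by rewrite mem_iota.
by case: j jk jm {jl} => [[a b] c] /= -> ->.
Qed.

Lemma iteration_drawsE k j : (j \in iteration_draws k) =
  [&& j.1.1 == k, (j.1.2 < calls k)%N & (j.2 < iters k)%N].
Proof.
apply/flatten_mapP/and3P => [[m]|[jk jm jl]].
  rewrite mem_iota /= call_drawsE => mc /and3P[jk /eqP jm jl].
  by rewrite jm.
by exists j.1.2; rewrite ?mem_iota // call_drawsE jk eqxx jl.
Qed.

Lemma all_drawsE K j : (j \in all_draws K) =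
  [&& (0 < j.1.1 <= K)%N, (j.1.2 < calls j.1.1)%N & (j.2 < iters j.1.1)%N].
Proof.
elim: K => [|K IH]; first by case: j => [[[|a] b] c].
rewrite mem_cat IH iteration_drawsE.
case: eqVneq => [->|ne] /=; first by rewrite ltnn leqnn.
by rewrite orbF [(j.1.1 <= K.+1)%N]leq_eqVlt (negPf ne) ltnS.
Qed.

Lemma all_draws_uniq K : uniq (all_draws K).
Proof.
have ucall k m : uniq (call_draws k m) by apply: mkseq_uniq => a b [].
have uiter k : uniq (iteration_draws k).
  rewrite /iteration_draws; elim: (iota _ _) (iota_uniq 0 (calls k)) => //= m ms IH.
  move=> /andP[mms /IH u]; rewrite cat_uniq ucall u andbT /=.
  apply/hasPn => j /flatten_mapP[m' m'ms]; rewrite !call_drawsE.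
  move=> /and3P[_ /eqP jm _]; apply/negP => /and3P[_ /eqP jm' _].
  by move: mms; rewrite -jm' jm m'ms.
elim: K => //= K IH; rewrite cat_uniq IH uiter andbT /=.
apply/hasPn => j; rewrite iteration_drawsE all_drawsE => /and3P[/eqP -> _ _].
by rewrite ltnn andbF.
Qed.

Lemma eq_arbcd_call k th xp v v' m :
  (forall j, j \in call_draws k m -> v j = v' j) ->
  arbcd_call D e Lgam iters v k th xp m = arbcd_call D e Lgam iters v' k th xp m.
Proof.
move=> E; rewrite /arbcd_call /arbcd.
rewrite (@eq_arbcd_state _ _ _ _ _ _ _ (fun l => v (k, m, l))
  (fun l => v' (k, m, l))) // => l lk.
by apply: E; rewrite call_drawsE /= !eqxx.
Qed.

Lemma eq_best_call k th xp v v' : (0 < k)%N ->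
  (forall j, j \in iteration_draws k -> v j = v' j) ->
  best_call D e Lgam calls iters v k th xp =
  best_call D e Lgam calls iters v' k th xp.
Proof.
move=> k0 E.
have EE : forall m : 'I_(calls k).-1.+1,
    arbcd_call D e Lgam iters v k th xp m = arbcd_call D e Lgam iters v' k th xp m.
  move=> m; apply: eq_arbcd_call => j; rewrite call_drawsE => /and3P[jk /eqP jm jl].
  by apply: E; rewrite iteration_drawsE jk jl jm andbT /=
    (leq_trans (ltn_ord m)) // prednK // calls_gt0.
rewrite /best_call -EE; congr arbcd_call; congr (nat_of_ord _).
by rewrite /Order.arg_min; congr extremum; apply/funext => m; rewrite EE.
Qed.

Lemma eq_state v v' k : (forall j, j \in all_draws k -> v j = v' j) ->
  arbcd_dfal_state D e Lgam x0 calls iters v k =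
  arbcd_dfal_state D e Lgam x0 calls iters v' k.
Proof.
elim: k => // k IH E /=; rewrite IH; last first.
  by move=> j jk; apply: E; rewrite /= mem_cat jk.
case: (arbcd_dfal_state _ _ _ _ _ _ _ _) => xp th.
rewrite (@eq_best_call _ _ _ v v') // => j jk.
by apply: E; rewrite /= mem_cat jk orbT.
Qed.

Lemma state_theta v k :
  (arbcd_dfal_state D e Lgam x0 calls iters v k).2 = theta_succ D (run v) k.
Proof.
elim: k => //= k <-; rewrite /run /arbcd_dfal /=.
by case: (arbcd_dfal_state _ _ _ _ _ _ _ _).
Qed.

Lemma run_step v k : run v k.+1 =
  best_call D e Lgam calls iters v k.+1 (theta D (run v) k.+1) (run v k).
Proof.
rewrite /theta [k.+1.-1]/= -state_theta /run /arbcd_dfal /=.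
by case: (arbcd_dfal_state _ _ _ _ _ _ _ _).
Qed.

Lemma eq_run v v' K k : (k <= K)%N -> (forall j, j \in all_draws K -> v j = v' j) ->
  run v k = run v' k.
Proof.
move=> kK E; rewrite /run /arbcd_dfal (@eq_state v v') // => j.
rewrite all_drawsE => /and3P[/andP[j0 jk] jc jl]; apply: E.
by rewrite all_drawsE j0 jc jl (leq_trans jk kK).
Qed.

Lemma agree_off_iteration v v' K : agree_off (iteration_draws K.+1) v v' ->
  forall j, j \in all_draws K -> v j = v' j.
Proof.
move=> ag j; rewrite all_drawsE => /and3P[/andP[_ jk] _ _].
rewrite ag // iteration_drawsE; apply/negP => /and3P[/eqP jK _ _].
by rewrite jK ltnn in jk.
Qed.

Definition past v K := forall k, (0 < k < K.+1)%N -> cond_a D (run v) k.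

Let amin k th := augmented_argmin gamP rhoP lam_gt0 k th.

(** All the calls must fail for the best one to fail, and by Markov's
    inequality each fails with probability at most [1/2]. *)
Lemma iteration_failure v K : past v K ->
  avg (iteration_draws K.+1)
    (fun v' => (~~ `[< cond_a D (run v') K.+1 >])%:R) v <=
  2^-1 ^+ calls K.+1 :> R.
Proof.
move=> pv; set k := K.+1; set th := theta D (run v) k; set xp := run v K.
have a0 : 0 <= alpha1 D by exact: ltW.
have good : good_until D (run v) K by move=> j jK; left; exact: pv.
have [xB xsB thB] := good_bounds amin a0 (ltW c0) bounds good.
have xpB : norm2 xp <= radius.
  rewrite /xp; case: (K) xB => [_|K' xB]; first by rewrite le_max lexx orbT.
  by rewrite le_max xB ?leqnn.
have [xs xsm] := amin k th.
have xsn : norm2 xs <= Bx by apply: xsB.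
pose F m v' := alpha D k < augmented D k th
  (arbcd_call D e Lgam iters v' k th xp m) - augmented D k th xs.
have FI m m' v1 v2 : m != m' -> agree_off (call_draws k m') v1 v2 ->
    F m v2 = F m v1.
  move=> mm ag; rewrite /F (@eq_arbcd_call _ _ _ v2 v1) // => j.
  rewrite call_drawsE => /and3P[_ jm _]; apply: ag; rewrite call_drawsE.
  by rewrite (eqP jm) (negPf mm) andbF.
have Fb m v' : avg (call_draws k m) (fun v' => (F m v')%:R) v' <= 2^-1 :> R.
  have scaled_convex i : convex_fun (fun y => lam D k * rho D i y).
    case: (rhoP i) => cf _ _; have l0 := ltW (lam_gt0 k).
    exact: (convex_fun_scale cf l0).
  have scaled_ge0 i y : 0 <= lam D k * rho D i y.
    by rewrite mulr_ge0 ?(rho_ge0 rhoP) // ltW // lam_gt0.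
  have cinj : injective (fun l : nat => (k, m, l) : J) by move=> a b /= [].

  have xsmin : is_argmin (composite (fun i y => lam D k * rho D i y)
      (smooth_part D k th)) xs.
    by move=> y; rewrite !composite_augmented.
  have large : 8 * N%:R ^+ 2 * (composite (fun i y => lam D k * rho D i y)
      (smooth_part D k th) xp - composite (fun i y => lam D k * rho D i y)
      (smooth_part D k th) xs + gap2 (block_const k) xs xp) <=
      alpha D k * (iters k)%:R ^+ 2.
    rewrite !composite_augmented; apply: le_trans (iters_large _) => //.
    by rewrite ler_wpM2l ?W_bound // mulr_ge0 // exprn_ge0.
  have := call_failure N_gt0 scaled_convex scaled_ge0 (block_const_gt0 k)
    (smooth_convex gamP lam_gt0 k th)
    (smooth_block syme svd A_def gamP lam_gt0 k th) xsmin cinj v'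
    (iters_gt0 (ltn0Sn K)) (alpha_gt0 k) large.
  apply: le_trans; rewrite le_eqVlt; apply/orP; left; apply/eqP.
  by apply: eq_avg => // v1 _; rewrite !composite_augmented.
have half0 : 0 <= 2^-1 :> R by rewrite invr_ge0.
have := avg_trials N_gt0 v half0 FI Fb (iota_uniq 0 (calls k)).
rewrite size_iota; apply: le_trans; apply: avg_le => // v' ag.
have ag' := agree_off_iteration ag.
have thE : theta D (run v') k = th.
  apply: eq_theta => j /andP[_ jk]; apply: esym; exact: eq_run ag'.
have xpE : run v' K = xp by apply: esym; exact: eq_run ag'.
rewrite ler_nat; case: asboolP => // nca; rewrite [nat_of_bool (~~ _)]/=.
suff -> : all (F ^~ v') (iota 0 (calls k)) by [].
apply/allP => m; rewrite mem_iota add0n => /andP[_ mc].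
rewrite /F ltNge; apply/negP => le; apply: nca; exists xs.
  by rewrite /Pk thE.
apply: le_trans le; rewrite /Pk run_step -/k thE xpE lerD2r.
have mlt : (m < (calls k).-1.+1)%N by rewrite prednK // calls_gt0.
rewrite /best_call; case: arg_minP => // i _ /(_ (Ordinal mlt) isT).
exact.
Qed.

Section Events.
Variables (d : measure_display) (T : measurableType d) (P : probability T R).
Variable draw : J -> T -> 'I_N.
Hypothesis iid : iid_uniform P draw.

Let X k w := run (fun j => draw j w) k.

Lemma measurable_run k i j : measurable_fun setT (fun w => X k w i j).
Proof.
move=> _ Y mY; rewrite setTI.
have dep : depends_on (all_draws k) (fun v => Y (run v k i j)).
  by move=> v v' E; rewrite (eq_run (leqnn k) E).
have v0 : J -> 'I_N := fun=> Ordinal N_gt0.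
by have [] := iid_avg iid v0 (all_draws_uniq k) dep.
Qed.

(** The past reads earlier draws only, so the bound on the failure of iteration [k]
    holds for each of their values and can be averaged over the past event. *)
Lemma iteration_prob k : (0 < k)%N ->
  ((1 - 2^-1 ^+ calls k)%:E * P (past_success D (fun=> false) X k) <=
   P (success D X k `&` past_success D (fun=> false) X k))%E.
Proof.
case: k => // K _.
pose v0 : J -> 'I_N := fun=> Ordinal N_gt0.
have Ek v v' k : (k <= K.+1)%N ->
    (forall j, j \in all_draws K.+1 -> v j = v' j) ->
    forall j, (0 < j <= k)%N -> run v j = run v' j.
  by move=> kK E j /andP[_ jk]; apply: eq_run E; exact: leq_trans jk kK.
have dep_past : depends_on (all_draws K.+1) (past^~ K).
  move=> v v' E pv k kK; have /andP[k0 kK'] := kK.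
  by apply: eq_cond_a (pv k kK) => //; apply: Ek E; exact: ltnW.
have dep_succ : depends_on (all_draws K.+1)
    (fun v => cond_a D (run v) K.+1 /\ past v K).
  move=> v v' E [sv pv]; split; last exact: dep_past pv.
  by apply: eq_cond_a sv => //; exact: Ek E.
have pastE : past_success D (fun=> false) X K.+1 =
    [set w | past (fun j => draw j w) K].
  by apply/seteqP; split=> w /= H k kK; [apply: H | move=> _; apply: H].
have succE : success D X K.+1 `&` past_success D (fun=> false) X K.+1 =
    [set w | cond_a D (run (fun j => draw j w)) K.+1 /\
             past (fun j => draw j w) K].
  by rewrite pastE.
rewrite succE pastE.
have [_ ->] := iid_avg iid v0 (all_draws_uniq K.+1) dep_past.
have [_ ->] := iid_avg iid v0 (all_draws_uniq K.+1) dep_succ.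
rewrite -EFinM lee_fin.
pose pa v : R := `[< past v K >]%:R.
pose fa v : R := (~~ `[< cond_a D (run v) K.+1 >])%:R.
have -> : avg (all_draws K.+1)
      (fun v => `[< cond_a D (run v) K.+1 /\ past v K >]%:R) v0 =
    avg (all_draws K.+1) pa v0 - avg (all_draws K.+1) (fun v => pa v * fa v) v0 :> R.
  rewrite -avgB; apply: eq_avg => // v _; rewrite /pa /fa asbool_and.
  by case: `[< cond_a _ _ _ >]; case: `[< past _ _ >];
    rewrite /= ?mulr0 ?mulr1 ?subr0 ?subrr.
have pa_off v v' : agree_off (iteration_draws K.+1) v v' -> pa v' = pa v.
  move=> /agree_off_iteration ag.
  have E k : (0 < k < K.+1)%N -> cond_a D (run v) k <-> cond_a D (run v') k.
    move=> /andP[k0 kK]; split; apply: eq_cond_a => // j /andP[_ jk].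
      by apply: eq_run ag; exact: leq_trans jk kK.
    by apply: esym; apply: eq_run ag; exact: leq_trans jk kK.
  apply: (f_equal (fun b : bool => b%:R)); apply: asbool_equiv_eq.
  split=> H k kK; first exact: (proj2 (E k kK) (H k kK)).
  exact: (proj1 (E k kK) (H k kK)).
rewrite mulrBl mul1r lerB // -avgZ /= !avg_cat; apply: avg_le => // v _.
rewrite (@eq_avg _ _ _ N_gt0 _ _ (fun v' => pa v * fa v')); last first.
  by move=> v' /pa_off ->.
rewrite avgZ (@eq_avg _ _ _ N_gt0 _ (fun v => 2^-1 ^+ calls K.+1 * pa v)
  (fun=> 2^-1 ^+ calls K.+1 * pa v)); last by move=> v' /pa_off ->.
rewrite avg_cst // [leRHS]mulrC /pa.
have [pv|npv] := pselect (past v K); last by rewrite asboolF // !mul0r.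
by rewrite asboolT // !mul1r; exact: iteration_failure.
Qed.

End Events.

End Calls.

End RandomizedRun.

(** * Numbers of calls and iterations *)

Section Counting.
Variable R : realType.

(** Enough independent trials of failure probability [1/2] for all of them to
    fail with probability at most [delta]. *)
Definition halvings (delta : R) : nat := (Num.trunc (ln delta^-1 / ln 2)).+1.

Let ln2 : 0 < ln 2 :> R. Proof. by rewrite ln_gt0 // ltr1n. Qed.

Lemma halvings_le delta : 0 < delta -> 2^-1 ^+ halvings delta <= delta.
Proof.
move=> d0; have pos : (2^-1 : R) ^+ halvings delta \is Num.pos.
  by rewrite posrE exprn_gt0 // invr_gt0.
rewrite -ler_ln ?posrE // lnXn ?invr_gt0 // lnV ?posrE //.
rewrite -[leLHS]mulr_natr.
have := truncnS_gt (ln delta^-1 / ln 2); rewrite -/(halvings delta).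
rewrite ltr_pdivrMr // lnV ?posrE // mulrC; lra.
Qed.

Lemma halvings_ub delta : 0 < delta <= 1 ->
  (halvings delta)%:R <= ln delta^-1 / ln 2 + 1.
Proof.
move=> /andP[d0 d1]; rewrite /halvings -natr1 lerD2r truncn_le.
by rewrite divr_ge0 ?(ltW ln2) // ln_ge0 // invf_ge1.
Qed.

Lemma prod_1B_ge (I : Type) (r : seq I) (F : I -> R) :
  (forall i, 0 <= F i <= 1) ->
  1 - \sum_(i <- r) F i <= \prod_(i <- r) (1 - F i).
Proof.
move=> F01; elim: r => [|i r IH]; first by rewrite !big_nil subr0.
rewrite !big_cons; have /andP[Fi0 Fi1] := F01 i.
have S0 : 0 <= \sum_(j <- r) F j by apply: sumr_ge0 => j _; case/andP: (F01 j).
have := ler_wpM2l (_ : 0 <= 1 - F i) IH; rewrite subr_ge0 => /(_ Fi1); nra.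
Qed.

(** A failure probability [p / K] is admissible for each of [K] iterations. *)
Lemma bernoulli_root (p : R) (K : nat) : (0 < K)%N -> 0 < p < 1 ->
  (1 - p) `^ K%:R^-1 <= 1 - p / K%:R.
Proof.
move=> K0 /andP[p0 p1]; have Kp : 0 < K%:R :> R by rewrite ltr0n.
have pK : 0 <= p / K%:R <= 1.
  rewrite divr_ge0 ?(ltW p0) //= ler_pdivrMr // mul1r (le_trans (ltW p1)) //.
  by rewrite ler1n.
have b0 : 0 <= 1 - p / K%:R by rewrite subr_ge0; case/andP: pK.
have := @prod_1B_ge _ (index_iota 0 K) (fun=> p / K%:R) (fun=> pK).
rewrite !sumr_const_nat prodr_const_nat subn0.
rewrite -[p / _ *+ K]mulr_natr divfK ?gt_eqF // => le.
have -> : 1 - p / K%:R = ((1 - p / K%:R) ^+ K) `^ K%:R^-1.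
  by rewrite -powR_mulrn // -powRrM divff ?gt_eqF // powRr1.
apply: ge0_ler_powR => //.
  by rewrite nnegrE subr_ge0 ltW.
by rewrite nnegrE exprn_ge0.
Qed.

(** In this sum and the next one the ratio exceeds 1, so the last term dominates. *)
Lemma geometric_sum_le (c : R) n : 0 < c < 1 ->
  \sum_(i < n.+1) c^-1 ^+ i <= c^-1 ^+ n / (1 - c).
Proof.
move=> /andP[c0 c1]; have c1' : 0 < 1 - c by rewrite subr_gt0.
elim: n => [|n IH].
  by rewrite big_ord1 !expr0 div1r invf_ge1 // gerBl ltW.
rewrite big_ord_recr /=; apply: le_trans (lerD IH (lexx _)) _.
by rewrite le_eqVlt (exprS c^-1 n); apply/orP; left; apply/eqP; field; rewrite !gt_eqF.
Qed.

Lemma weighted_geometric_sum_le (c : R) n : 0 < c < 1 ->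
  \sum_(i < n.+1) (n.+1 - i)%:R * c^-1 ^+ i <= c^-1 ^+ n / (1 - c) ^+ 2.
Proof.
move=> c01; have /andP[c0 c1] := c01; have c1' : 0 < 1 - c by rewrite subr_gt0.
elim: n => [|n IH].
  rewrite big_ord1 subn0 mulr1 expr0 div1r invf_ge1 ?exprn_gt0 //.
  by apply: exprn_ile1; [exact: ltW | rewrite gerBl ltW].
rewrite big_ord_recr /= subSnn mul1r.
under eq_bigr => i _ do rewrite subSn ?(ltnW (ltn_ord i)) // -natr1 mulrDl mul1r.
rewrite big_split /= -addrA.
have geo := geometric_sum_le n.+1 c01; rewrite big_ord_recr /= in geo.
apply: le_trans (lerD IH geo) _.
by rewrite le_eqVlt (exprS c^-1 n); apply/orP; left; apply/eqP; field; rewrite !gt_eqF.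
Qed.

Lemma half_sum_le n : \sum_(i < n) 2^-1 ^+ i.+1 <= 1 :> R.
Proof.
have half0 m : 0 <= 2^-1 ^+ m :> R by rewrite exprn_ge0 // invr_ge0.
suff H : \sum_(i < n) 2^-1 ^+ i.+1 <= 1 - 2^-1 ^+ n :> R.
  by apply: le_trans H _; rewrite gerBl.
elim: n => [|n IH]; first by rewrite big_ord0 expr0 subrr.
rewrite big_ord_recr /= exprS; move: IH; lra.
Qed.

End Counting.

Section Complexity.
Variables (R : realType) (N n r : nat) (D : dfal_data R N n r).
Hypothesis c01 : 0 < cfac D < 1.
Hypothesis alpha1_gt0 : 0 < alpha1 D.
Variable Cbar : R.
Hypothesis Cbar_gt0 : 0 < Cbar.

Let c0 : 0 < cfac D. Proof. by case/andP: c01. Qed.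
Let c1 : cfac D < 1. Proof. by case/andP: c01. Qed.

Lemma Neps_gt0 eps : (0 < Neps D Cbar eps)%N.
Proof. by rewrite /Neps leq_maxl. Qed.

(** Rounding the logarithm up costs at most one factor [1/c]. *)
Lemma inv_c_Neps_le eps eps0 : 0 < eps <= eps0 ->
  (cfac D)^-1 ^+ (Neps D Cbar eps).-1 <= (eps0 + Cbar) / eps.
Proof.
move=> /andP[e0 ee0]; set K := Neps D Cbar eps.
have lnc : 0 < ln (cfac D)^-1 by rewrite ln_gt0 // invf_gt1.
have [K1|K1] := leqP K 1.
  have -> : K.-1 = 0%N by case: (K) K1 => [|[]].
  by rewrite expr0 ler_pdivlMr // mul1r (le_trans ee0) // lerDl ltW.
have Klt : K.-1%:R < log_inv_c D (Cbar / eps).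
  move: K1; rewrite /K /Neps; set a := log_inv_c _ _.
  rewrite leq_max /= => m1; rewrite (maxn_idPr (ltnW m1)).
  have [le0|gt0] := leP (Num.ceil a) 0; first by rewrite (max_idPl le0) in m1.
  rewrite (max_idPr (ltW gt0)) in m1 *.
  apply: le_lt_trans (ceilB1_lt a).
  rewrite intrB -[X in _ <= X%:~R - _]gez0_abs ?(ltW gt0) // -pmulrn.
  by rewrite lerBrDr natr1 prednK // ltnW.
have pos : (cfac D)^-1 ^+ K.-1 \is Num.pos by rewrite posrE exprn_gt0 // invr_gt0.
apply: (@le_trans _ _ (Cbar / eps)).
  rewrite -ler_ln ?posrE ?divr_gt0 // lnXn ?invr_gt0 //.
  move: Klt; rewrite /log_inv_c ltr_pdivlMr // mulr_natl; exact: ltW.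
by rewrite ler_pM2r ?invr_gt0 // lerDr (le_trans (ltW e0)).
Qed.

Lemma sqrt_alpha k : Num.sqrt (alpha D k) = cfac D ^+ k.-1 * Num.sqrt (alpha1 D).
Proof.
rewrite /alpha -exprM mulnC exprM sqrtrM ?sqr_ge0 // sqrtr_sqr ger0_norm //.
by rewrite exprn_ge0 // ltW.
Qed.

Lemma alpha_le k : alpha D k <= alpha1 D.
Proof.
by apply: ler_piMl; [exact: ltW | rewrite !exprn_ile1 ?exprn_ge0 ?(ltW c0) ?(ltW c1)].
Qed.

(** [W] bounds the initial gap that the rate of one call is proportional to. *)
Definition call_length (W : R) k : nat :=
  (Num.trunc (Num.sqrt (8 * N%:R ^+ 2 * W / alpha D k))).+1.

Lemma call_length_large W k : 0 <= W ->
  8 * N%:R ^+ 2 * W <= alpha D k * (call_length W k)%:R ^+ 2.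
Proof.
move=> W0; have a0 : 0 < alpha D k by rewrite mulr_gt0 // !exprn_gt0.
have x0 : 0 <= 8 * N%:R ^+ 2 * W / alpha D k.
  by rewrite divr_ge0 ?(ltW a0) // !mulr_ge0 // exprn_ge0.
rewrite [leRHS]mulrC -ler_pdivrMr // -(sqr_sqrtr x0).
rewrite ler_pXn2r ?nnegrE ?sqrtr_ge0 //; exact/ltW/truncnS_gt.
Qed.

Lemma call_length_le W k : 0 <= W -> (call_length W k)%:R <=
  (Num.sqrt (8 * N%:R ^+ 2 * W) + Num.sqrt (alpha1 D)) / Num.sqrt (alpha D k).
Proof.
move=> W0; have a0 : 0 < alpha D k by rewrite mulr_gt0 // !exprn_gt0.
have s0 : 0 < Num.sqrt (alpha D k) by rewrite sqrtr_gt0.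
have x0 : 0 <= 8 * N%:R ^+ 2 * W by rewrite !mulr_ge0 // exprn_ge0.
rewrite /call_length -[X in X <= _]natr1 [leRHS]mulrDl lerD //.
  apply: (@le_trans _ _ (Num.sqrt (8 * N%:R ^+ 2 * W / alpha D k))).
    by rewrite truncn_le sqrtr_ge0.
  by rewrite sqrtrM // sqrtrV ?(ltW a0).
rewrite ler_pdivlMr // mul1r; apply: ler_wsqrtr; exact: alpha_le.
Qed.

End Complexity.

(** * From success of the iterations to the two claims *)

Section Guarantee.
Variables (R : realType) (N n r : nat) (e : rel 'I_N) (D : dfal_data R N n r).
Variables (U : 'M[R]_(#|edges e| * n, r)) (s : 'rV[R]_r) (V : 'M[R]_(N * n, r)).
Variables (Lgam lbgam B tau : 'I_N -> R) (Fstar Cbar : R).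
Hypothesis graph : simple_connected_graph e.
Hypothesis svd : reduced_svd (consensus_mx R e n) U s V.
Hypothesis A_def : Amx D = diag_mx s *m V^T.
Hypothesis gamP : forall i, class_Gamma (gam D i) (Lgam i) (lbgam i).
Hypothesis rhoP : forall i, class_R (rho D i) (B i) (tau i).
Hypothesis c01 : 0 < cfac D < 1.
Hypothesis lam1_gt0 : 0 < lam1 D.
Hypothesis alpha1_gt0 : 0 < alpha1 D.
Hypothesis rate : dfal_rate D Fstar Cbar.

Lemma success_prob_eps_solution (d : measure_display) (T : measurableType d)
    (P : probability T R) (useb : pred nat) (x : nat -> T -> 'M[R]_(N, n))
    (q : nat -> R) (eps : R) (K := Neps D Cbar eps) : 0 < eps ->
  (forall k i j, (0 < k <= K)%N -> measurable_fun setT (fun w => x k w i j)) ->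
  (forall k w, (0 < k <= K)%N -> useb k -> cond_b D (fun j => x j w) k) ->
  (forall k, (0 < k <= K)%N -> 0 <= q k) ->
  (forall k, (0 < k <= K)%N -> ~~ useb k ->
    ((q k)%:E * P (past_success D useb x k) <=
     P (success D x k `&` past_success D useb x k))%E) ->
  ((\prod_(1 <= k < K.+1 | ~~ useb k) q k)%:E <=
   P [set w | eps_solution D e Fstar eps (x K w)])%E.
Proof.
move=> eps0 mx xb q0 qP; have [syme irre _] := graph.
have rc := rho_continuous rhoP; have gc := gam_continuous gamP.
have lam0 := lam_gt0 c01 lam1_gt0.
have ac := augmented_continuous gamP rhoP.
have amin := augmented_argmin gamP rhoP lam0.
have K0 : (0 < K)%N by exact: Neps_gt0.
apply: le_trans (past_success_ge q0 qP) _.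
apply: le_measure; rewrite ?inE.
- apply: (measurable_past_success rc gc ac amin) => l i j /andP[l0 lK].
  by apply: mx; rewrite l0 -ltnS.
- by apply: measurable_eps_solution => // i j; apply: mx; rewrite K0 leqnn.
move=> w /= pw; have /andP[c0 _] := c01.
apply: (@good_eps_solution _ _ _ _ D amin e (fun k => x k w)) => //.
- by move=> y i j; exact: edge_gap_le svd A_def y syme irre i j.
- exact: ltW.
- exact: ltW.
move=> k kK; have [ub|nb] := boolP (useb k); first by right; exact: xb.
by left; apply: pw.
Qed.

End Guarantee.

Theorem theorem4 (R : realType) (N n r : nat) (e : rel 'I_N)
    (D : dfal_data R N n r)
    (U : 'M[R]_(#|edges e| * n, r)) (s : 'rV[R]_r) (V : 'M[R]_(N * n, r))
    (Lgam lbgam B tau : 'I_N -> R)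
    (Fstar lambar Bx Btheta Cbar : R) (x0 : 'M[R]_(N, n)) :
  (0 < N)%N ->
  simple_connected_graph e ->
  (forall i, class_Gamma (gam D i) (Lgam i) (lbgam i)) ->
  (forall i, class_R (rho D i) (B i) (tau i)) ->
  (exists2 xopt, is_argmin (Fsum D) xopt & Fstar = Fsum D xopt) ->
  reduced_svd (consensus_mx R e n) U s V ->
  Amx D = diag_mx s *m V^T ->
  0 < cfac D < 1 ->
  0 < lambar -> 0 < Bx -> 0 < Btheta ->
  0 < lam1 D <= lambar -> 0 < alpha1 D -> 0 < xi1 D ->
  (forall i, xi1 D / lam1 D < tau i) ->
  dfal_bounds D Bx Btheta ->
  0 < Cbar ->
  dfal_rate D Fstar Cbar ->
  (forall eps p : R, 0 < eps -> 0 < p < 1 ->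
   forall (d : measure_display) (T : measurableType d) (P : probability T R)
     (useb : pred nat) (x : nat -> T -> 'M[R]_(N, n)),
   async_dfal D P p (Neps D Cbar eps) useb x ->
   ((1 - p)%:E <=
    P [set w | eps_solution D e Fstar eps (x (Neps D Cbar eps) w)])%E)
  /\
  ((forall i, 0 < Lgam i + (degree e i)%:R) ->
   forall eps0 p0 : R, 0 < eps0 -> 0 < p0 < 1 ->
   exists2 kappa : R, 0 < kappa &
   forall eps p : R, 0 < eps <= eps0 -> 0 < p <= p0 ->
   let K := Neps D Cbar eps in
   (exists calls iters : nat -> nat,
     [/\ forall k, (0 < k <= K)%N ->
           [/\ (0 < calls k)%N, (calls k)%:R <= kappa * ln (K%:R / p),
               (0 < iters k)%N & (iters k)%:R <= kappa / Num.sqrt (alpha D k)],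
         (total_iters calls iters K)%:R <= kappa * (eps^-1 * ln (K%:R / p)),
         p <= K%:R^-1 ->
           (total_iters calls iters K)%:R <= kappa * (eps^-1 * ln p^-1)
       & forall (d : measure_display) (T : measurableType d)
           (P : probability T R) (draw : nat * nat * nat -> T -> 'I_N),
         iid_uniform P draw ->
         async_dfal D P p K (fun=> false)
           (fun k w =>
              arbcd_dfal D e Lgam x0 calls iters (fun j => draw j w) k)])
   /\
   (exists calls iters : nat -> nat,
     [/\ forall k, (0 < k <= K)%N ->
           [/\ (0 < calls k)%N,
               (0 < iters k)%N & (iters k)%:R <= kappa / Num.sqrt (alpha D k)],
         (total_iters calls iters K)%:R <= kappa * (eps^-1 * ln p^-1)
       & forall (d : measure_display) (T : measurableType d)
           (P : probability T R) (draw : nat * nat * nat -> T -> 'I_N),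
         iid_uniform P draw ->
         ((1 - p)%:E <=
          P [set w | eps_solution D e Fstar eps
               (arbcd_dfal D e Lgam x0 calls iters (fun j => draw j w) K)])%E])).
Proof.
move=> N0 graph gamP rhoP _ svd A_def c01 _ Bx0 Bth0 /andP[lam0 _] alpha0 _ _.
move=> bounds Cbar0 rate; have [syme irre _] := graph.
have /andP[c0 c1] := c01.
split=> [eps p eps0 /andP[p0 p1] d T P useb x [mx xb xa]|Lpos eps0 p0 e0 /andP[pp0 pp1]].
  set K := Neps D Cbar eps in mx xb xa *.
  pose q : R := (1 - p) `^ K%:R^-1.
  have K0 : (0 < K)%N by exact: Neps_gt0.
  have q0 : 0 <= q by exact: powR_ge0.
  have q1 : q <= 1.
    apply: le_trans (bernoulli_root K0 _) _; first by rewrite p0.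
    by rewrite gerBl divr_ge0 ?(ltW p0).
  apply: le_trans (success_prob_eps_solution graph svd A_def gamP rhoP c01 lam0
    alpha0 rate (q := fun=> q) eps0 mx xb _ xa) => //.
  rewrite lee_fin.
  have -> : 1 - p = \prod_(1 <= k < K.+1) q.
    rewrite prodr_const_nat subSS subn0 -powR_mulrn // -powRrM mulVf ?powRr1 //.
      by rewrite subr_ge0 ltW.
    by rewrite pnatr_eq0 -lt0n.
  rewrite [leRHS]big_mkcond; apply: ler_prod => k _.
  by case: ifP => _; rewrite q0 ?lexx ?q1.
have [W W0 W_bound] := uniform_start_gap x0 svd A_def gamP rhoP c01 lam0 Lpos
  Bx0 Bth0.
pose iters := call_length D W.
have iters_large k : (0 < k)%N -> 8 * N%:R ^+ 2 * W <= alpha D k * (iters k)%:R ^+ 2.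
  by move=> _; apply: call_length_large => //; exact: ltW.
pose k1 : R := Num.sqrt (8 * N%:R ^+ 2 * W) + Num.sqrt (alpha1 D).
have sa0 : 0 < Num.sqrt (alpha1 D) by rewrite sqrtr_gt0.
have k10 : 0 < k1 by rewrite ltr_wpDl // sqrtr_ge0.
have iters_le k : (iters k)%:R <= k1 / Num.sqrt (alpha D k).
  by apply: call_length_le => //; exact: ltW.
pose L0 : R := ln p0^-1.
have L00 : 0 < L0 by rewrite ln_gt0 // invf_gt1.
have ln2 : 0 < ln 2 :> R by rewrite ln_gt0 // ltr1n.
pose k2 : R := 2 / L0 + (ln 2)^-1.
have k20 : 0 < k2 by rewrite addr_gt0 ?invr_gt0 ?divr_gt0.
(* The summand 2 is absorbed because [ln p^-1 >= L0] is bounded away from 0. *)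
have k2_ge y : L0 <= y -> y / ln 2 + 2 <= k2 * y.
  move=> Ly; have h : 1 <= y / L0 by rewrite ler_pdivlMr // mul1r.
  rewrite (_ : k2 * y = 2 * (y / L0) + y / ln 2); last by rewrite /k2; ring.
  by rewrite addrC lerD2r ler_peMr.
(* [(1 - c)^-2] bounds the sum of [j c^(j-1)], and [(eps0 + Cbar) / eps] the
   power of [1/c] reached at iteration [K]. *)
pose k3 : R := k2 * (k1 / Num.sqrt (alpha1 D)) *
  ((eps0 + Cbar) / (1 - cfac D) ^+ 2).
have c1' : 0 < 1 - cfac D by rewrite subr_gt0.
have k30 : 0 < k3 by rewrite !mulr_gt0 ?invr_gt0 ?exprn_gt0 // addr_gt0.
exists (k1 + k2 + 2 * k3); first by lra.
have total3 X : 0 <= X -> 2 * k3 * X <= (k1 + k2 + 2 * k3) * X.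
  by move=> X0; rewrite ler_wpM2r //; lra.
have total1 X : 0 <= X -> k3 * X <= (k1 + k2 + 2 * k3) * X.
  by move=> X0; rewrite ler_wpM2r //; lra.
have total2 X : 0 <= X -> k2 * X <= (k1 + k2 + 2 * k3) * X.
  by move=> X0; rewrite ler_wpM2r //; lra.
move=> eps p eps_bd /andP[p_gt0 p_le] K; have /andP[eps_gt0 eps_le] := eps_bd.
have K0 : (0 < K)%N by exact: Neps_gt0.
have K1 : 1 <= K%:R :> R by rewrite ler1n.
have Kgt0 : 0 < K%:R :> R by rewrite ltr0n.
have p1 : p < 1 by exact: le_lt_trans p_le pp1.
pose Lp : R := ln p^-1.
have Lp_ge : L0 <= Lp.
  by rewrite /L0 /Lp ler_ln ?posrE ?invr_gt0 // lef_pV2 ?posrE.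
have Lp0 : 0 < Lp by exact: lt_le_trans Lp_ge.
have iters_ok k : (iters k)%:R <= (k1 + k2 + 2 * k3) / Num.sqrt (alpha D k).
  apply: le_trans (iters_le k) _; rewrite ler_wpM2r ?invr_ge0 ?sqrtr_ge0 //.
  by lra.
have sqrtE i : (Num.sqrt (alpha D i.+1))^-1 =
    (Num.sqrt (alpha1 D))^-1 * (cfac D)^-1 ^+ i.
  by rewrite sqrt_alpha // invfM exprVn mulrC.
have cK := inv_c_Neps_le c01 Cbar0 eps_bd; rewrite -/K in cK.
(* The numbers of calls enter the total cost through a sum against [c^-i], the
   growth of the lengths of the calls; it is measured by its last term. *)
have total_le (calls : nat -> nat) (a : nat -> R) (b : R) :
    (forall i, (i < K)%N -> (calls i.+1)%:R <= a i) ->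
    \sum_(i < K) a i * (cfac D)^-1 ^+ i <= b * (cfac D)^-1 ^+ K.-1 -> 0 <= b ->
    (total_iters calls iters K)%:R <=
      b * (k1 / Num.sqrt (alpha1 D)) * ((eps0 + Cbar) / eps).
  move=> ca sum_le b0; rewrite /total_iters natr_sum big_add1 big_mkord.
  apply: (@le_trans _ _ (k1 / Num.sqrt (alpha1 D) *
      \sum_(i < K) a i * (cfac D)^-1 ^+ i)).
    rewrite mulr_sumr; apply: ler_sum => i _; rewrite natrM.
    have -> : k1 / Num.sqrt (alpha1 D) * (a i * (cfac D)^-1 ^+ i) =
        a i * (k1 / Num.sqrt (alpha D i.+1)) by rewrite sqrtE; ring.
    by apply: ler_pM => //; apply: ca.
  rewrite [leRHS](_ : _ = k1 / Num.sqrt (alpha1 D) * (b * ((eps0 + Cbar) / eps))).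
    rewrite ler_wpM2l ?divr_ge0 ?(ltW k10) ?sqrtr_ge0 //.
    by apply: le_trans sum_le _; rewrite ler_wpM2l.
  by ring.
have prob (calls : nat -> nat) (calls0 : forall k, (0 < k)%N -> (0 < calls k)%N)
    (d : measure_display) (T : measurableType d) (P : probability T R)
    (draw : nat * nat * nat -> T -> 'I_N) (iid : iid_uniform P draw) k :=
  @iteration_prob _ _ _ _ e D U s V Lgam lbgam B tau Bx Btheta x0 N0 syme svd
    A_def gamP rhoP c01 lam0 alpha0 Lpos bounds calls iters W calls0
    (fun _ _ => ltn0Sn _) W_bound iters_large d T P draw iid k.
have meas (calls : nat -> nat) (calls0 : forall k, (0 < k)%N -> (0 < calls k)%N)
    (d : measure_display) (T : measurableType d) (P : probability T R)
    (draw : nat * nat * nat -> T -> 'I_N) (iid : iid_uniform P draw) k i j :=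
  @measurable_run _ _ _ _ e D Lgam x0 N0 calls iters calls0 d T P draw iid k i j.
split.
  pose delta := p / K%:R.
  have d0 : 0 < delta by rewrite divr_gt0.
  have d1 : delta <= 1.
    by rewrite ler_pdivrMr // mul1r (le_trans (ltW p1)).
  have LK : ln delta^-1 = ln (K%:R / p) by rewrite invf_div.
  have LKE : ln (K%:R / p) = ln K%:R + Lp by rewrite lnM ?posrE ?invr_gt0.
  have lnK0 : 0 <= ln K%:R :> R by exact: ln_ge0.
  have LK0 : 0 < ln (K%:R / p) by rewrite LKE ltr_wpDl.
  have calls_le : (halvings delta)%:R <= k2 * ln (K%:R / p).
    apply: le_trans (halvings_ub _) _; first by rewrite d0.
    have LKL : L0 <= ln (K%:R / p) by rewrite LKE (le_trans Lp_ge) // lerDr.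
    by rewrite LK; apply: le_trans (k2_ge _ LKL); rewrite lerD2l ler1n.
  have total : (total_iters (fun=> halvings delta) iters K)%:R <=
      k3 * (eps^-1 * ln (K%:R / p)).
    pose a := k2 * ln (K%:R / p).
    have a0 : 0 <= a by rewrite mulr_ge0 ?ltW.
    apply: le_trans (@total_le _ (fun=> a) (a / (1 - cfac D) ^+ 2) _ _ _) _ => //.
    - rewrite -mulr_sumr -mulrA ler_wpM2l //.
      case: (K) K0 => // m _; apply: le_trans (geometric_sum_le m c01) _.
      rewrite mulrC ler_wpM2r ?exprn_ge0 ?invr_ge0 ?(ltW c0) //.
      rewrite lef_pV2 ?posrE ?exprn_gt0 // expr2 ler_piMl ?(ltW c1') //.
      by rewrite gerBl ltW.
    - by rewrite divr_ge0 // exprn_ge0 // ltW.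
    rewrite le_eqVlt; apply/orP; left; apply/eqP; rewrite /a /k3; field.
    by rewrite !gt_eqF.
  exists (fun=> halvings delta), iters; split.
  - move=> k _; split=> //; apply: (le_trans calls_le).
    exact: total2 (ltW LK0).
  - by apply: le_trans total (total1 _ _); rewrite mulr_ge0 ?invr_ge0 // ltW.
  - move=> pK; apply: le_trans total _.
    have lnKp : ln K%:R <= Lp.
      by rewrite /Lp ler_ln ?posrE ?invr_gt0 // -[leLHS]invrK lef_pV2 ?posrE ?invr_gt0.
    apply: (@le_trans _ _ (2 * k3 * (eps^-1 * Lp))).
      rewrite [leRHS](_ : _ = k3 * (eps^-1 * (2 * Lp))); last by ring.
      rewrite ler_wpM2l ?(ltW k30) // ler_wpM2l ?invr_ge0 ?(ltW eps_gt0) //.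
      by rewrite LKE mulr2n mulrDl mul1r lerD2r.
    by apply: total3; rewrite mulr_ge0 ?invr_ge0 // ltW.
  move=> d T P draw iid; split=> //; first move=> k i j _.
    exact: (meas (fun=> halvings delta) (fun _ _ => ltn0Sn _) _ _ _ _ iid k i j).
  move=> k /andP[k0 _] _.
  apply: le_trans (prob (fun=> halvings delta) (fun _ _ => ltn0Sn _) _ _ _ _ iid k k0).
  rewrite lee_wpmul2r ?measure_ge0 // lee_fin.
  apply: le_trans (bernoulli_root K0 _) _; first by rewrite p_gt0.
  by rewrite lerB // halvings_le.
(* These failure probabilities add up to at most [p]; the strict ones fall on the
   early iterations, whose calls are short. *)
pose delta k : R := p * 2^-1 ^+ (K.+1 - k).
pose calls k := halvings (delta k).
have d0 k : 0 < delta k by rewrite mulr_gt0 // exprn_gt0 // invr_gt0.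
have d1 k : delta k <= 1.
  rewrite mulr_ile1 ?(ltW p_gt0) ?(ltW p1) ?exprn_ge0 ?invr_ge0 //.
  by rewrite exprn_ile1 ?invr_ge0 // invf_le1 // ler1n.
have calls_le i : (i < K)%N -> (calls i.+1)%:R <= k2 * Lp * (K - i)%:R.
  move=> iK; apply: le_trans (halvings_ub _) _; first by rewrite d0 d1.
  rewrite /delta subSS invfM lnM ?posrE ?invr_gt0 ?exprn_gt0 ?invr_gt0 // -/Lp.
  rewrite -exprVn invrK lnXn // mulrDl -[ln 2 *+ _]mulr_natl mulfK ?gt_eqF //.
  have Ki : 1 <= (K - i)%:R :> R by rewrite ler1n subn_gt0.
  have := ler_wpM2r (ler0n R (K - i)) (k2_ge _ Lp_ge); apply: le_trans.
  have q0 : 0 <= Lp / ln 2 by rewrite divr_ge0 // ltW.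
  move: (Lp / ln 2) q0 ((K - i)%:R) Ki => a a0 b b1.
  rewrite mulrDl -addrA lerD //; first by rewrite ler_peMr.
  by rewrite mulr2n mulrDl mul1r lerD2l.
exists calls, iters; split.
- by move=> k _; split.
- apply: le_trans (@total_le calls (fun i => k2 * Lp * (K - i)%:R)
    (k2 * Lp / (1 - cfac D) ^+ 2) calls_le _ _) _.
  + have a0 : 0 <= k2 * Lp by rewrite mulr_ge0 ?ltW.
    under eq_bigr => i _ do rewrite -mulrA.
    rewrite -mulr_sumr -[leRHS]mulrA ler_wpM2l // [leRHS]mulrC.
    by case: (K) K0 => // m _; exact: weighted_geometric_sum_le.
  + by rewrite divr_ge0 ?exprn_ge0 ?mulr_ge0 ?ltW.
  rewrite [leLHS](_ : _ = k3 * (eps^-1 * Lp)).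
    by apply: total1; rewrite mulr_ge0 ?invr_ge0 // ltW.
  by rewrite /k3; field; rewrite !gt_eqF.
move=> d T P draw iid.
have half k : 0 <= (2^-1 : R) ^+ calls k <= 1.
  by rewrite exprn_ge0 ?invr_ge0 //= (le_trans (halvings_le (d0 k))).
apply: le_trans (success_prob_eps_solution graph svd A_def gamP rhoP c01 lam0
  alpha0 rate (useb := fun=> false) (q := fun k => 1 - 2^-1 ^+ calls k) eps_gt0
  (fun k i j _ => meas calls (fun _ _ => ltn0Sn _) _ _ _ _ iid k i j) _ _ _) => //.
- rewrite lee_fin; apply: le_trans (prod_1B_ge _ half).
  rewrite lerB // (@le_trans _ _ (\sum_(1 <= k < K.+1) delta k)) //.
    by apply: ler_sum => k _; exact: halvings_le.
  rewrite -mulr_sumr ler_piMr ?(ltW p_gt0) //.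
  rewrite big_add1 big_mkord (reindex_inj rev_ord_inj) /=.
  under eq_bigr => i _ do rewrite subSS subKn ?(ltn_ord i) //.
  exact: half_sum_le.
- by move=> k _; rewrite subr_ge0; case/andP: (half k).
by move=> k /andP[k0 _] _; exact: prob (fun _ _ => ltn0Sn _) _ _ _ _ iid k k0.
Qed.
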